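(* Let $X$ and $Y$ be good topological spaces and let $p:Y\to X$ be a covering map. Then $p_*:\Pi(Y)\to\Pi(X)$, $p_*([\gamma])=[p\circ\gamma]$, is also a covering map. Moreover, the deck transformation groups $\mathrm{Deck}(Y/X)$ and $\mathrm{Deck}(\Pi(Y)/\Pi(X))$ (of $p$ and $p_*$ respectively) are isomorphic. Also, if $\widetilde{X}$ is the universal cover of $X$, then $\Pi(\widetilde{X})$ is the universal cover of $\Pi(X)$ (with covering map induced by the universal covering map $\widetilde X\to X$).
   Context: A space is good if it is path connected and admits a universal cover; equivalently, it is path connected, locally path connected and semilocally simply connected. An open subset $U\subseteq X$ is nice if it is path connected and the inclusion induces the trivial map $\pi_1(U,x)\to\pi_1(X,x)$ for every $x\in U$; in a good space the nice open sets form a basis of the topology. Let $I=[0,1]$. $\Pi(X)$ is the set of homotopy classes relative to endpoints $[\gamma]$ of paths $\gamma:I\to X$, with the topology having as basis the sets $S(U,V,[\gamma])=\{[\delta_1*\gamma*\delta_2]\}$, where $U,V\subseteq X$ are nice open sets, $\gamma$ is a path with $\gamma(0)\in U$ and $\gamma(1)\in V$, and $\delta_1$ (resp. $\delta_2$) ranges over the paths contained in $U$ ending at $\gamma(0)$ (resp. contained in $V$ starting at $\gamma(1)$); $*$ is concatenation. *)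

(* Defs.v *)
From HB Require Import structures.
From mathcomp Require Import all_boot all_order all_algebra generic_quotient.
From mathcomp Require Import mathcomp_extra boolp classical_sets functions.
From mathcomp Require Import set_interval reals topology normedtype.
From mathcomp Require Import realfun homotopy lra.

Set Implicit Arguments.
Unset Strict Implicit.
Unset Printing Implicit Defensive.

Import Order.TTheory GRing.Theory Num.Theory.
Import numFieldNormedType.Exports.

Local Open Scope classical_set_scope.
Local Open Scope ring_scope.
Local Open Scope quotient_scope.

Section unit_interval.
Context (R : realType).

Definition unit_interval : Type := set_type (`[0, 1]%classic : set R).

HB.instance Definition _ :=
  Topological.copy unit_interval (set_type (`[0, 1]%classic : set R)).

Definition ival (t : unit_interval) : R := set_val t.

Lemma clamp_subproof (r : R) :
  Num.max 0 (Num.min 1 r) \in (`[0, 1]%classic : set R).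
Proof.
by rewrite inE /= in_itv /= le_max lexx /= ge_max ler01 ge_min lexx.
Qed.

Definition clamp (r : R) : unit_interval :=
  exist (fun x : R => x \in (`[0, 1]%classic : set R)) _ (clamp_subproof r).

Lemma ival_itv t : 0 <= ival t <= 1.
Proof. by have := set_valP t; rewrite /= in_itv. Qed.

Lemma ival_inj : injective ival.
Proof. by move=> [x xP] [y yP] /= xy; apply: eq_exist. Qed.

Lemma clampE r : ival (clamp r) = Num.max 0 (Num.min 1 r).
Proof. by []. Qed.

Lemma clampK r : 0 <= r <= 1 -> ival (clamp r) = r.
Proof.
by case/andP=> r0 r1; rewrite clampE (min_idPr r1) (max_idPr r0).
Qed.

Lemma ivalK t : clamp (ival t) = t.
Proof. by apply: ival_inj; rewrite clampK// ival_itv. Qed.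

Lemma ival_continuous : continuous ival.
Proof. exact: initial_continuous. Qed.

Lemma clamp_continuous : continuous clamp.
Proof.
apply: continuous_comp_initial.
move=> r; apply: (@continuous_max R R (cst 0) (Num.min 1)).
  exact: cst_continuous.
apply: (@continuous_min R R (cst 1) id); [exact: cst_continuous|by []].
Qed.

Lemma clamp0_neq_clamp1 : clamp 0 != clamp 1.
Proof.
apply/eqP => /(congr1 ival); rewrite !clampK ?lexx ?ler01//.
by move/eqP; rewrite eq_sym oner_eq0.
Qed.

HB.instance Definition _ :=
  isBiPointed.Build unit_interval clamp0_neq_clamp1.

Lemma ival_zero : ival zero = 0.
Proof. by rewrite clampK// lexx ler01. Qed.

Lemma ival_one : ival one = 1.
Proof. by rewrite clampK// lexx ler01. Qed.

End unit_interval.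

Lemma continuous_if_le (R : realType) (T U : topologicalType) (h : T -> R)
    (a : R) (f g : T -> U) :
  continuous h -> continuous f -> continuous g ->
  (forall t, h t = a -> f t = g t) ->
  continuous (fun t => if h t <= a then f t else g t).
Proof.
move=> ch cf cg fg; apply/continuous_subspace_setT.
pose A := h @^-1` [set r | r <= a]; pose B := h @^-1` [set r | a <= r].
have -> : [set: T] = A `|` B.
  by apply/esym; rewrite -subTset => t _; rewrite /A /B /=;
    case/orP: (le_total (h t) a) => ?; [left|right].
apply: withinU_continuous.
- by apply: preimage_closed => //; exact: closed_le.
- by apply: preimage_closed => //; exact: closed_ge.
- apply: (@subspace_eq_continuous _ A U f); last exact: continuous_subspaceT.
  by move=> t; rewrite inE /A /= => ha; rewrite /from_subspace ha.
- apply: (@subspace_eq_continuous _ B U g); last exact: continuous_subspaceT.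
  move=> t; rewrite inE /B /= => ah; rewrite /from_subspace; case: ifP => // ha.
  by rewrite fg//; apply/eqP; rewrite eq_le ha ah.
Qed.

Lemma continuous_pair (T U V : topologicalType) (f : T -> U) (g : T -> V) :
  continuous f -> continuous g -> continuous (fun t => (f t, g t)).
Proof. by move=> cf cg t; apply: (cvg_pair (cf t) (cg t)). Qed.

Section homotopy.
Context (R : realType) (X : topologicalType).
Local Notation I := (unit_interval R).

(* Homotopy relative to the endpoints; the homotopy parameter comes first. *)
Definition homotopic (f g : I -> X) : Prop :=
  exists H : I * I -> X,
    [/\ continuous H,
        forall t, H (zero, t) = f t,
        forall t, H (one, t) = g t,
        forall s, H (s, zero) = f zero &
        forall s, H (s, one) = f one].

Lemma homotopic_ends f g : homotopic f g -> f zero = g zero /\ f one = g one.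
Proof. by case=> H [_ _ H1 Hz Ho]; rewrite -!H1 Hz Ho. Qed.

Lemma homotopic_refl f : continuous f -> homotopic f f.
Proof.
move=> cf; exists (f \o snd); split=> // -[s t].
by apply: continuous_comp; [exact: cvg_snd|exact: cf].
Qed.

Lemma homotopic_sym f g : homotopic f g -> homotopic g f.
Proof.
move=> /[dup] /homotopic_ends[fg0 fg1] [H [cH H0 H1 Hz Ho]].
exists (fun st => H (clamp (1 - ival st.1), st.2)); split.
- move=> st; apply: continuous_comp (cH _).
  apply: continuous_pair => {}st; last exact: cvg_snd.
  apply: continuous_comp; last exact: clamp_continuous.
  apply: (@continuousB R R^o); first exact: cvg_cst.
  by apply: continuous_comp; [exact: cvg_fst|exact: ival_continuous].
- by move=> t /=; rewrite ival_zero subr0 H1.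
- by move=> t /=; rewrite ival_one subrr H0.
- by move=> s /=; rewrite Hz fg0.
- by move=> s /=; rewrite Ho fg1.
Qed.

Lemma homotopic_trans g f h : homotopic f g -> homotopic g h -> homotopic f h.
Proof.
move=> /[dup] /homotopic_ends[fg0 fg1] [H [cH H0 H1 Hz Ho]].
move=> [K [cK K0 K1 Kz Ko]].
exists (fun st => if ival st.1 <= 2^-1 then H (clamp (2 * ival st.1), st.2)
                  else K (clamp (2 * ival st.1 - 1), st.2)).
have civ : continuous (fun st : I * I => ival st.1).
  by move=> st; apply: continuous_comp; [exact: cvg_fst|exact: ival_continuous].
have c2 : continuous (fun st : I * I => 2 * ival st.1).
  by move=> st; apply: (continuous_comp (civ st)); exact: mulrl_continuous.
split.
- apply: continuous_if_le => //.
  + move=> st; apply: continuous_comp (cH _).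
    apply: continuous_pair => {}st; last exact: cvg_snd.
    by apply: continuous_comp; [exact: c2|exact: clamp_continuous].
  + move=> st; apply: continuous_comp (cK _).
    apply: continuous_pair => {}st; last exact: cvg_snd.
    apply: continuous_comp; last exact: clamp_continuous.
    by apply: (@continuousB R R^o); [exact: c2|exact: cvg_cst].
  + by move=> [s t] /= ->; rewrite divff ?pnatr_eq0// subrr H1 K0.
- by move=> t /=; rewrite ival_zero invr_ge0 ler0n mulr0 H0.
- move=> t /=; rewrite ival_one mulr1.
  have -> : (1 <= 2^-1 :> R) = false by apply/negP; lra.
  by rewrite (_ : 2 - 1 = 1 :> R) ?K1//; lra.
- by move=> s /=; case: ifP => _; rewrite ?Hz ?Kz.
- by move=> s /=; case: ifP => _; rewrite ?Ho ?Ko.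
Qed.

Definition homotopicb (f g : continuousType I X) := `[< homotopic f g >].

Lemma homotopicb_refl : reflexive homotopicb.
Proof. by move=> f; apply/asboolP/homotopic_refl/cts_fun. Qed.

Lemma homotopicb_sym : symmetric homotopicb.
Proof.
by move=> f g; apply/asboolP/asboolP; exact: homotopic_sym.
Qed.

Lemma homotopicb_trans : transitive homotopicb.
Proof.
by move=> g f h /asboolP fg /asboolP gh; apply/asboolP/(homotopic_trans fg).
Qed.

Canonical homotopicb_equiv :=
  EquivRel homotopicb homotopicb_refl homotopicb_sym homotopicb_trans.

End homotopy.

Section concatenation.
Context (R : realType) (X : topologicalType).
Local Notation I := (unit_interval R).

(* On the branch taken, the argument of clamp lies in [0, 1]. *)
Definition concat_fun (f g : I -> X) (t : I) : X :=
  if ival t <= 2^-1 then f (clamp (2 * ival t)) else g (clamp (2 * ival t - 1)).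

Context (x y z : X) (f : {path I from x to y}) (g : {path I from y to z}).

Definition concat : I -> X := concat_fun f g.

Lemma concat_continuous : continuous concat.
Proof.
have c2 : continuous (fun t : I => 2 * ival t).
  move=> t; apply: (continuous_comp (@ival_continuous R t)).
  exact: mulrl_continuous.
apply: continuous_if_le; first exact: ival_continuous.
- move=> t; apply: (@continuous_comp _ _ _ (fun t => clamp (2 * ival t)) f).
    by apply: continuous_comp; [exact: c2|exact: clamp_continuous].
  exact: cts_fun.
- move=> t; apply: (@continuous_comp _ _ _ (fun t => clamp (2 * ival t - 1)) g).
    apply: continuous_comp; last exact: clamp_continuous.
    by apply: (@continuousB R R^o); [exact: c2|exact: cst_continuous].
  exact: cts_fun.
- by move=> t ->; rewrite divff ?pnatr_eq0// subrr path_one path_zero.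
Qed.

Lemma concat_zero : concat zero = x.
Proof.
by rewrite /concat /concat_fun ival_zero invr_ge0 ler0n mulr0 path_zero.
Qed.

Lemma concat_one : concat one = z.
Proof.
rewrite /concat /concat_fun ival_one mulr1.
have -> : (1 <= 2^-1 :> R) = false by apply/negP; lra.
by rewrite (_ : 2 - 1 = 1 :> R) ?path_one//; lra.
Qed.

HB.instance Definition _ := isContinuous.Build I X concat concat_continuous.
HB.instance Definition _ := isPath.Build I X x z concat concat_zero concat_one.

End concatenation.

Section spaces.
Context (R : realType) (X : topologicalType).
Local Notation I := (unit_interval R).
Implicit Types (U V W : set X) (x y : X).

(* In particular nonempty. *)
Definition path_connected U : Prop :=
  U !=set0 /\
  forall x y, U x -> U y ->
    exists f : {path I from x to y}, range f `<=` U.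

(* The inclusion of U induces the trivial map from pi_1(U, x) to pi_1(X, x). *)
Definition trivial_on_pi1 U x : Prop :=
  forall f : {path I from x to x}, range f `<=` U -> homotopic f (cst x).

Definition nice U : Prop :=
  [/\ open U, path_connected U & forall x, U x -> trivial_on_pi1 U x].

Definition locally_path_connected : Prop :=
  forall x W, nbhs x W ->
    exists U, [/\ open U, U x, path_connected U & U `<=` W].

Definition semilocally_simply_connected : Prop :=
  forall x, exists U, [/\ open U, U x & trivial_on_pi1 U x].

Definition good_space : Prop :=
  [/\ path_connected setT, locally_path_connected &
      semilocally_simply_connected].

Definition simply_connected : Prop :=
  path_connected setT /\ forall x, trivial_on_pi1 setT x.

End spaces.

Section Pi.
Context (R : realType) (X : topologicalType).
Local Notation I := (unit_interval R).

Definition Pi : Type := {eq_quot (@homotopicb_equiv R X)}.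

HB.instance Definition _ := Choice.on Pi.
HB.instance Definition _ := Quotient.on Pi.

Definition path_class (f : continuousType I X) : Pi := \pi_Pi f.

Lemma path_classP f g : path_class f = path_class g <-> homotopic f g.
Proof. by split=> [/eqmodP/asboolP//|fg]; apply/eqmodP/asboolP. Qed.

(* The set S(U, V, [f]). *)
Definition Pi_box (U V : set X) x y (f : {path I from x to y}) : set Pi :=
  [set c | exists x' y' (d1 : {path I from x' to x})
                        (d2 : {path I from y to y'}),
    [/\ range d1 `<=` U, range d2 `<=` V &
        c = path_class (concat (concat d1 f) d2)]].

Definition Pi_basis : set (set Pi) :=
  [set B | exists U V x y (f : {path I from x to y}),
    [/\ nice R U, nice R V, U x, V y & B = Pi_box U V f]].

(* On a good space Pi_basis is a basis, and the topology it generates is the one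
   having it as a basis; generating it as a subbase makes sense for any X. *)
HB.instance Definition _ :=
  isSubBaseTopological.Build Pi Pi_basis id.

End Pi.

Section Pi_map.
Context (R : realType) (X Y : topologicalType) (p : continuousType Y X).
Local Notation I := (unit_interval R).

Definition Pi_map (c : Pi R Y) : Pi R X := path_class (p \o repr c).

Lemma Pi_mapE (f : continuousType I Y) :
  Pi_map (path_class f) = path_class (p \o f).
Proof.
apply/path_classP; have : path_class (repr (path_class f)) = path_class f.
  by rewrite /path_class reprK.
move=> /path_classP[H [cH H0 H1 Hz Ho]]; exists (p \o H).
split=> [st|t|t|s|s] /=.
- by apply: continuous_comp; [exact: cH|exact: cts_fun].
- by rewrite H0.
- by rewrite H1.
- by rewrite Hz.
- by rewrite Ho.
Qed.

End Pi_map.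

Arguments Pi_map R {X Y} p.

Section covering.
Context (R : realType) (Y X : topologicalType) (p : Y -> X).

(* g stands for the inverse U -> V; its values outside U are irrelevant. *)
Definition restricts_to_homeo (V : set Y) (U : set X) : Prop :=
  exists g : X -> Y,
    [/\ {within V, continuous p}, {within U, continuous g},
        set_fun V U p, set_fun U V g &
        {in V, cancel p g} /\ {in U, cancel g p}].

Definition evenly_covered (U : set X) : Prop :=
  exists F : set (set Y),
    [/\ trivIset F id, \bigcup_(V in F) V = p @^-1` U &
        forall V, F V -> open V /\ restricts_to_homeo V U].

Definition covering_map : Prop :=
  [/\ continuous p, set_surj setT setT p &
      forall x, exists U, [/\ open U, U x & evenly_covered U]].

(* Without local path connectedness, every simply connected space would be a
   universal cover of itself, hence not every space with a universal cover would
   be good. *)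
Definition universal_covering : Prop :=
  [/\ covering_map, simply_connected R Y & locally_path_connected R Y].

End covering.

Arguments universal_covering R {Y X} p.

Section deck.
Context (Y X : topologicalType) (p : Y -> X).

Definition homeomorphism (f : Y -> Y) : Prop :=
  continuous f /\
  exists g : Y -> Y, [/\ continuous g, cancel f g & cancel g f].

Record deck : Type := Deck {
  deck_fun :> Y -> Y ;
  deck_homeo : homeomorphism deck_fun ;
  deck_over : p \o deck_fun = p
}.

HB.instance Definition _ := gen_eqMixin deck.
HB.instance Definition _ := gen_choiceMixin deck.

Lemma deck_eqP (f g : deck) : f =1 g -> f = g.
Proof.
case: f g => [f fh fo] [g gh go] /= /funext fg; rewrite fg in fh fo *.
by congr Deck; exact: Prop_irrelevance.
Qed.

Lemma deck_id_homeo : homeomorphism idfun.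
Proof.
split=> [y|]; first exact: cvg_id.
by exists idfun; split=> // y; exact: cvg_id.
Qed.

Definition deck_id : deck := Deck deck_id_homeo erefl.

Lemma deck_comp_homeo (f g : deck) : homeomorphism (f \o g).
Proof.
have [cf [f' [cf' fK f'K]]] := deck_homeo f.
have [cg [g' [cg' gK g'K]]] := deck_homeo g.
split; first by move=> y; apply: continuous_comp; [exact: cg|exact: cf].
exists (g' \o f'); split; [|exact: can_comp|exact: can_comp].
by move=> y; apply: continuous_comp; [exact: cf'|exact: cg'].
Qed.

Lemma deck_comp_over (f g : deck) : p \o (f \o g) = p.
Proof. by rewrite compA !deck_over. Qed.

Definition deck_comp (f g : deck) : deck :=
  Deck (deck_comp_homeo f g) (deck_comp_over f g).

Definition deck_inv_fun (f : deck) : Y -> Y := projT1 (cid (deck_homeo f).2).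

Lemma deck_inv_funP (f : deck) :
  [/\ continuous (deck_inv_fun f), cancel f (deck_inv_fun f) &
      cancel (deck_inv_fun f) f].
Proof. exact: projT2 (cid (deck_homeo f).2). Qed.

Lemma deck_inv_homeo (f : deck) : homeomorphism (deck_inv_fun f).
Proof.
have [cg fK gK] := deck_inv_funP f; split=> //.
by exists f; split=> //; exact: (deck_homeo f).1.
Qed.

Lemma deck_inv_over (f : deck) : p \o deck_inv_fun f = p.
Proof.
have [_ _ gK] := deck_inv_funP f.
by rewrite -[in LHS](deck_over f) -compA; apply/funext => y /=; rewrite gK.
Qed.

Definition deck_inv (f : deck) : deck :=
  Deck (deck_inv_homeo f) (deck_inv_over f).

Lemma deck_compA : associative deck_comp.
Proof. by move=> f g h; exact: deck_eqP. Qed.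

Lemma deck_comp1 : right_id deck_id deck_comp.
Proof. by move=> f; exact: deck_eqP. Qed.

Lemma deck_1comp : left_id deck_id deck_comp.
Proof. by move=> f; exact: deck_eqP. Qed.

Lemma deck_compV : right_inverse deck_id deck_inv deck_comp.
Proof.
move=> f; apply: deck_eqP => y.
by case: (deck_inv_funP f) => _ fK gK; exact: gK.
Qed.

Lemma deck_Vcomp : left_inverse deck_id deck_inv deck_comp.
Proof.
move=> f; apply: deck_eqP => y.
by case: (deck_inv_funP f) => _ fK gK; exact: fK.
Qed.

HB.instance Definition _ := isGroup.Build deck
  deck_compA deck_1comp deck_comp1 deck_Vcomp deck_compV.

End deck.

(* Main.v *)
(** A basic neighbourhood of [[f]] in Pi(X) consists of the classes of the paths
    freely homotopic to [f] with endpoints moving in open sets [U] and [V].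
    Lifting such homotopies through [p] shows that the preimage of a box around
    [[h]], with [U] and [V] evenly covered, splits into the boxes around the lifts
    of [h] bounded by sheets over [U] and [V]. A deck transformation [F] of
    Pi(Y) maps constant classes to constant classes, hence induces a deck
    transformation [f] of [Y]; as every class is joined to a constant one by its
    initial segments, unique lifting forces [F] to be induced by [f]. If [X] is
    simply connected, the two endpoint maps identify Pi(X) with [X * X]. *)

Require Import Defs.
From HB Require Import structures.
From mathcomp Require Import all_boot all_order all_algebra generic_quotient.
From mathcomp Require Import finmap.
From mathcomp Require Import mathcomp_extra boolp classical_sets functions.
From mathcomp Require Import reals topology normedtype homotopy lra.

Set Implicit Arguments.
Unset Strict Implicit.
Unset Printing Implicit Defensive.

Import Order.TTheory GRing.Theory Num.Theory.
Import numFieldNormedType.Exports.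

Local Open Scope classical_set_scope.
Local Open Scope ring_scope.
Local Open Scope quotient_scope.

(** A box defined by concatenations is awkward to move from one centre to another. [Pi_boxP]
    replaces it by homotopies whose two ends satisfy a condition throughout. This relation is
    symmetric and transitive, so a box is also the box around each of its members, and the condition
    makes sense for arbitrary open sets, not only nice ones. Evenly covered sets can therefore bound
    a box directly. A sheet over such a box is labelled by a lift of its centre, and unique lifting
    then gives disjointness. Two devices replace the usual subdivisions. Homotopies between paths
    are drawn in a square, where convexity joins any two paths with common ends. Lifts are extended
    along the interval by connectedness instead of a Lebesgue number. *)

Lemma comp_continuous (T U V : topologicalType) (f : T -> U) (g : U -> V) :
  continuous f -> continuous g -> continuous (fun x => g (f x)).
Proof. by move=> cf cg x; apply: continuous_comp; [exact: cf|exact: cg]. Qed.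

Lemma fst_continuous (T U : topologicalType) : continuous (@fst T U).
Proof. by move=> x; exact: cvg_fst. Qed.

Lemma snd_continuous (T U : topologicalType) : continuous (@snd T U).
Proof. by move=> x; exact: cvg_snd. Qed.

Lemma pairl_continuous (T U : topologicalType) (x : T) :
  continuous (fun y : U => (x, y)).
Proof. by apply: continuous_pair; [exact: cst_continuous|move=> y; exact: cvg_id]. Qed.

Lemma pairr_continuous (T U : topologicalType) (y : U) :
  continuous (fun x : T => (x, y)).
Proof. by apply: continuous_pair; [move=> x; exact: cvg_id|exact: cst_continuous]. Qed.

Section real_valued.
Context (R : realType) (T : topologicalType).
Implicit Types f g : T -> R.

Lemma fun_addr_continuous f g :
  continuous f -> continuous g -> continuous (fun x => f x + g x).
Proof. by move=> cf cg x; apply: (@cvgD R R^o); [exact: cf|exact: cg]. Qed.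

Lemma fun_oppr_continuous f : continuous f -> continuous (fun x => - f x).
Proof. by move=> cf x; apply: (@cvgN R R^o); exact: cf. Qed.

Lemma fun_mulr_continuous f g :
  continuous f -> continuous g -> continuous (fun x => f x * g x).
Proof. by move=> cf cg x; apply: cvgM; [exact: cf|exact: cg]. Qed.

End real_valued.

(** * The unit interval *)

Section unit_interval_paths.
Context (R : realType).
Local Notation I := (unit_interval R).
Implicit Types (s t u : I) (T : topologicalType).

Definition lerp u s t : I :=
  clamp ((1 - ival u) * ival s + ival u * ival t).

Lemma ival_lerp u s t :
  ival (lerp u s t) = (1 - ival u) * ival s + ival u * ival t.
Proof.
have := ival_itv u; have := ival_itv s; have := ival_itv t.
move=> /andP[t0 t1] /andP[s0 s1] /andP[u0 u1].
by rewrite clampK//; apply/andP; split; nra.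
Qed.

Lemma lerp0 s t : lerp zero s t = s.
Proof. by apply: ival_inj; rewrite ival_lerp ival_zero; lra. Qed.

Lemma lerp1 s t : lerp one s t = t.
Proof. by apply: ival_inj; rewrite ival_lerp ival_one; lra. Qed.

Lemma lerpxx u s : lerp u s s = s.
Proof. by apply: ival_inj; rewrite ival_lerp; lra. Qed.

Lemma comp_ival_continuous T (f : T -> I) :
  continuous f -> continuous (fun x => ival (f x)).
Proof. by move=> cf; apply: comp_continuous cf _; exact: ival_continuous. Qed.

Lemma comp_clamp_continuous T (h : T -> R) :
  continuous h -> continuous (fun x => @clamp R (h x)).
Proof. by move=> ch; apply: comp_continuous ch _; exact: clamp_continuous. Qed.

Lemma lerp_continuous T (u s t : T -> I) :
  continuous u -> continuous s -> continuous t ->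
  continuous (fun x => lerp (u x) (s x) (t x)).
Proof.
move=> cu cs ct; apply: comp_clamp_continuous; apply: fun_addr_continuous;
  apply: fun_mulr_continuous; try exact: comp_ival_continuous.
apply: fun_addr_continuous; first by move=> x; exact: cst_continuous.
by apply: fun_oppr_continuous; exact: comp_ival_continuous.
Qed.

Lemma connected_unit_interval : connected [set: I].
Proof.
have -> : [set: I] = @clamp R @` `[0, 1]%classic.
  apply/esym; rewrite -subTset => t _; exists (ival t); last exact: ivalK.
  by rewrite /= in_itv /=; exact: ival_itv.
apply: connected_continuous_connected; first exact: segment_connected.
apply: continuous_subspaceT; exact: clamp_continuous.
Qed.

Lemma nbhs_ival (s0 : I) (e : R) : 0 < e ->
  nbhs s0 [set s | `|ival s - ival s0| < e].
Proof.
move=> e0; have /cvgrPdist_lt/(_ e e0) := @ival_continuous R s0.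
by apply: filterS => s /=; rewrite distrC.
Qed.

Lemma nbhs_ivalP (s0 : I) (N : set I) : nbhs s0 N ->
  exists2 e : R, 0 < e & forall s, `|ival s - ival s0| < e -> N s.
Proof.
rewrite -{1}(ivalK s0) => /(@clamp_continuous R (ival s0)) /nbhs_ballP[e /= e0 eN].
exists e => // s se; rewrite -(ivalK s); apply: eN.
by rewrite /ball /= distrC.
Qed.

(** The hypothesis makes [P] locally constant, hence clopen, and the interval is connected. This
    takes the place of a Lebesgue-number subdivision in all lifting arguments. *)
Lemma unit_interval_ind (P : I -> Prop) (s0 : I) :
  (forall s, exists2 N, nbhs s N & forall t u, N t -> N u -> P t -> P u) ->
  P s0 -> forall s, P s.
Proof.
move=> PN Ps0; have opP : open P.
  rewrite openE => s Ps; have [N Ns NP] := PN s.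
  by apply: filterS (Ns) => t Nt; apply: NP Ps => //; exact: nbhs_singleton.
have clP : closed P.
  move=> s /= clPs; have [N Ns NP] := PN s.
  have [t [Pt Nt]] := clPs _ Ns.
  by apply: NP Pt => //; exact: nbhs_singleton.
have PT : P = setT.
  apply: connected_unit_interval; first by exists s0.
    by exists P => //; rewrite setTI.
  by exists P => //; rewrite setTI.
by move=> s; rewrite PT.
Qed.

Lemma lerp_ball (s0 s t u : I) (e : R) :
  `|ival s - ival s0| < e -> `|ival t - ival s0| < e ->
  `|ival (lerp u s t) - ival s0| < e.
Proof.
have /andP[u0 u1] := ival_itv u.
rewrite ival_lerp !ltr_norml => /andP[a b] /andP[c d].
(* One weight may vanish, so strictness has to come from the other term. *)
have mix (x y : R) : 0 < x -> 0 < y -> 0 < (1 - ival u) * x + ival u * y.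
  move=> x0 y0; have [->|un0] := eqVneq (ival u) 0.
    by rewrite subr0 mul1r mul0r addr0.
  apply: ltr_wpDl; first by rewrite mulr_ge0 ?subr_ge0// ltW.
  by rewrite mulr_gt0// lt_def un0.
apply/andP; split.
- have := mix (ival s - ival s0 + e) (ival t - ival s0 + e); lra.
- have := mix (e - (ival s - ival s0)) (e - (ival t - ival s0)); lra.
Qed.

End unit_interval_paths.

(** * Concatenation of plain functions *)

Section concatenation.
Context (R : realType) (X : topologicalType).
Implicit Types f g : unit_interval R -> X.

Lemma concat_fun0 f g : concat_fun f g zero = f zero.
Proof.
rewrite /concat_fun ival_zero invr_ge0 ler0n mulr0.
by congr f; apply: ival_inj; rewrite clampK ?ival_zero// lexx ler01.
Qed.

Lemma concat_fun1 f g : concat_fun f g one = g one.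
Proof.
rewrite /concat_fun ival_one mulr1.
have -> : (1 <= 2^-1 :> R) = false by apply/negP; lra.
by congr g; apply: ival_inj; rewrite clampK ?ival_one; [lra|apply/andP; split; lra].
Qed.

Lemma concat_fun_continuous f g :
  continuous f -> continuous g -> f one = g zero -> continuous (concat_fun f g).
Proof.
move=> cf cg fg.
exact: (@concat_continuous R X _ _ _ (mk_path cf erefl fg)
                                     (mk_path cg erefl erefl)).
Qed.

End concatenation.

(** The path goes around the square, avoiding the side where the first coordinate is zero: [m] rises
    on the first third, stays at one and falls on the last, while [n] moves only on the middle
    third. It shares its ends with the avoided side, so convexity of the square makes the two
    homotopic. *)
Lemma three_sides_of_square (R : realType) :
  exists c : unit_interval R -> unit_interval R * unit_interval R,
    [/\ continuous c, c zero = (zero, zero), c one = (zero, one) &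
        forall t, [\/ (c t).2 = zero, (c t).1 = one | (c t).2 = one]].
Proof.
set I := unit_interval R.
pose m (t : I) : I := clamp (Num.min (3 * ival t) (3 - 3 * ival t)).
pose n (t : I) : I := clamp (3 * ival t - 1).
have c3 : continuous (fun t : I => 3 * ival t).
  by apply: fun_mulr_continuous; [exact: cst_continuous|exact: ival_continuous].
have cm : continuous m.
  apply: comp_clamp_continuous => t.
  apply: (@continuous_min R I (fun t => 3 * ival t) (fun t => 3 - 3 * ival t)).
    exact: c3.
  apply: (@fun_addr_continuous R I (cst 3)); first exact: cst_continuous.
  exact: fun_oppr_continuous.
have cn : continuous n.
  apply: comp_clamp_continuous; apply: fun_addr_continuous => //.
  exact: cst_continuous.
have clamp_le0 (r : R) : r <= 0 -> clamp r = zero :> I.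
  move=> r0; apply: ival_inj; rewrite ival_zero clampE.
  by rewrite (min_idPr _) ?(max_idPl _)//; lra.
have clamp_ge1 (r : R) : 1 <= r -> clamp r = one :> I.
  move=> r0; apply: ival_inj; rewrite ival_one clampE.
  by rewrite (min_idPl _) ?(max_idPr _)//; lra.
have m0 : m zero = zero.
  by apply: clamp_le0; rewrite ival_zero ge_min; apply/orP; left; lra.
have m1 : m one = zero.
  by apply: clamp_le0; rewrite ival_one ge_min; apply/orP; right; lra.
have n0 : n zero = zero by apply: clamp_le0; rewrite ival_zero; lra.
have n1 : n one = one by apply: clamp_ge1; rewrite ival_one; lra.
exists (fun t => (m t, n t)); split=> [|||t].
- exact: continuous_pair.
- by rewrite m0 n0.
- by rewrite m1 n1.
have /andP[t0 t1] := ival_itv t.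
have [h1|h1] := lerP (ival t) (1 / 3).
  by apply: Or31; apply: clamp_le0; lra.
have [h2|h2] := lerP (2 / 3) (ival t).
  by apply: Or33; apply: clamp_ge1; lra.
apply: Or32; apply: clamp_ge1; rewrite le_min; apply/andP; split; lra.
Qed.

(** * Free homotopies *)

Section free_homotopy.
Context (R : realType) (X : topologicalType).
Local Notation I := (unit_interval R).
Implicit Types (U V : set X) (A B : set (X * X)) (f g h : I -> X).

(** The ends are constrained jointly by a set of pairs so that one notion serves three purposes:
    products of open sets give boxes, a singleton gives homotopy relative to endpoints, the diagonal
    gives deformation of a loop through loops. *)
Definition free_homotopic A f g : Prop :=
  exists H : I * I -> X,
    [/\ continuous H,
        forall t, H (zero, t) = f t,
        forall t, H (one, t) = g t &
        forall s, A (H (s, zero), H (s, one))].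

Lemma free_homotopic_refl A f :
  continuous f -> A (f zero, f one) -> free_homotopic A f f.
Proof.
move=> cf Af; exists (f \o snd); split=> //.
by apply: comp_continuous cf; exact: snd_continuous.
Qed.

Lemma free_homotopic_sym A f g : free_homotopic A f g -> free_homotopic A g f.
Proof.
move=> [H [cH H0 H1 HA]].
exists (fun st => H (lerp st.1 one zero, st.2)); split=> [|t|t|s] /=.
- apply: comp_continuous cH; apply: continuous_pair; last exact: snd_continuous.
  by apply: lerp_continuous; [exact: fst_continuous|exact: cst_continuous..].
- by rewrite lerp0 H1.
- by rewrite lerp1 H0.
- exact: HA.
Qed.

Lemma free_homotopic_trans A g f h :
  free_homotopic A f g -> free_homotopic A g h -> free_homotopic A f h.
Proof.
move=> [H [cH H0 H1 HA]] [K [cK K0 K1 KA]].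
pose c (st : I * I) := ival st.1.
have cc : continuous c.
  by apply: comp_ival_continuous; exact: fst_continuous.
have c2 : continuous (fun st => 2 * c st).
  by apply: fun_mulr_continuous => //; exact: cst_continuous.
exists (fun st => if c st <= 2^-1 then H (clamp (2 * c st), st.2)
                  else K (clamp (2 * c st - 1), st.2)).
split=> [|t|t|s]; rewrite /c /=.
- apply: continuous_if_le => //.
  + apply: comp_continuous cH; apply: continuous_pair; last exact: snd_continuous.
    exact: comp_clamp_continuous.
  + apply: comp_continuous cK; apply: continuous_pair; last exact: snd_continuous.
    apply: comp_clamp_continuous; apply: fun_addr_continuous => //.
    exact: cst_continuous.
  + by move=> [s t] /= ->; rewrite divff ?pnatr_eq0// subrr H1 K0.
- by rewrite ival_zero invr_ge0 ler0n mulr0 H0.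
- rewrite ival_one mulr1.
  have -> : (1 <= 2^-1 :> R) = false by apply/negP; lra.
  by rewrite (_ : 2 - 1 = 1 :> R) ?K1//; lra.
- by case: ifP => _; [exact: HA|exact: KA].
Qed.

Lemma free_homotopic_continuousr A f g : free_homotopic A f g -> continuous g.
Proof.
move=> [H [cH _ H1 _]].
rewrite (_ : g = fun t => H (one, t)); last by apply/funext => t.
by apply: comp_continuous cH; exact: pairl_continuous.
Qed.

Lemma free_homotopic_endsr A f g : free_homotopic A f g -> A (g zero, g one).
Proof. by move=> [H [_ _ H1 HA]]; rewrite -!H1. Qed.

Lemma free_homotopicS A B f g : A `<=` B ->
  free_homotopic A f g -> free_homotopic B f g.
Proof. by move=> AB [H [cH H0 H1 HA]]; exists H; split=> // s; exact/AB/HA. Qed.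

Lemma homotopicP f g :
  homotopic f g <-> free_homotopic [set (f zero, f one)] f g.
Proof.
split=> [[H [cH H0 H1 Hz Ho]]|[H [cH H0 H1 HA]]]; exists H; split=> //.
- by move=> s; rewrite Hz Ho.
- by move=> s; have [] := HA s.
- by move=> s; have [] := HA s.
Qed.

Lemma homotopic_free A f g : A (f zero, f one) ->
  homotopic f g -> free_homotopic A f g.
Proof. by move=> Af /homotopicP; apply: free_homotopicS => _ ->. Qed.

(* The square is convex, so any two paths in it with the same endpoints are
   homotopic along straight segments. *)
Lemma square_homotopic (G : I * I -> X) (a b : I -> I * I) :
  continuous G -> continuous a -> continuous b ->
  a zero = b zero -> a one = b one -> homotopic (G \o a) (G \o b).
Proof.
move=> cG ca cb ab0 ab1.
exists (fun st => G (lerp st.1 (a st.2).1 (b st.2).1,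
                     lerp st.1 (a st.2).2 (b st.2).2)).
split=> [|t|t|s|s] /=; rewrite ?lerp0 ?lerp1 -?surjective_pairing -?ab0 -?ab1
  ?lerpxx -?surjective_pairing //.
have c2 (h : I -> I * I) : continuous h -> continuous (fun st : I * I => h st.2).
  by apply: comp_continuous; exact: snd_continuous.
apply: comp_continuous cG; apply: continuous_pair; apply: lerp_continuous;
  try exact: fst_continuous;
  first [apply: comp_continuous (c2 _ ca) _|apply: comp_continuous (c2 _ cb) _];
  solve [exact: fst_continuous|exact: snd_continuous].
Qed.

(** In the double concatenation [f] occupies the window from 1/4 to 1/2. Widening this window
    linearly to the whole interval moves its left end backwards along [d1] and its right end
    forwards along [d2]. *)
Lemma free_homotopic_concat A d1 f d2 :
  continuous d1 -> continuous f -> continuous d2 ->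
  d1 one = f zero -> f one = d2 zero ->
  (forall s, A (d1 (lerp s one zero), d2 s)) ->
  free_homotopic A f (concat_fun (concat_fun d1 f) d2).
Proof.
move=> cd1 cf cd2 df fd dA; set P := concat_fun _ d2.
have cP : continuous P.
  apply: concat_fun_continuous => //; first exact: concat_fun_continuous.
  by rewrite concat_fun1.
have q1 : ival (clamp 4^-1 : I) = 4^-1 by rewrite clampK//; apply/andP; split; lra.
have q2 : ival (clamp 2^-1 : I) = 2^-1 by rewrite clampK//; apply/andP; split; lra.
exists (fun st => P (lerp st.1 (lerp st.2 (clamp 4^-1) (clamp 2^-1)) st.2)).
split=> [|t|t|s] /=; rewrite ?lerp0 ?lerp1//.
- apply: comp_continuous cP; apply: lerp_continuous; last exact: snd_continuous.
    exact: fst_continuous.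
  by apply: lerp_continuous; [exact: snd_continuous|exact: cst_continuous..].
- have /andP[t0 t1] := ival_itv t.
  rewrite /P /concat_fun ival_lerp q1 q2 ifT; last by lra.
  rewrite clampK; last by apply/andP; split; lra.
  (* The branch test is non-strict, so at [t = zero] the value is read off the end of [d1]; the
     gluing condition reconciles it with [f]. *)
  case: ifPn => h.
    have t00 : t = zero by apply: ival_inj; rewrite ival_zero; lra.
    by rewrite t00 -df; congr d1; apply: ival_inj;
      rewrite ival_zero ival_one clampK//; [lra|apply/andP; split; lra].
  by congr f; apply: ival_inj; rewrite clampK//; [lra|apply/andP; split; lra].
- have /andP[t0 t1] := ival_itv s.
  suff [e1 e2] : P (lerp s (clamp 4^-1) zero) =
      d1 (lerp s one zero) /\
      P (lerp s (clamp 2^-1) one) = d2 s.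
    by have := dA s; rewrite -e1 -e2.
  rewrite /P /concat_fun ival_lerp q1 ival_zero; split.
    rewrite ifT; last by lra.
    rewrite clampK; last by apply/andP; split; lra.
    rewrite ifT; last by lra.
    congr d1; apply: ival_inj; rewrite ival_lerp ival_one ival_zero clampK; [lra|].
    by apply/andP; split; lra.
  rewrite ival_lerp q2 ival_one; case: ifPn => h.
    rewrite clampK; last by apply/andP; split; lra.
    rewrite ifF; last by apply/negP; lra.
    have -> : clamp (2 * (2 * ((1 - ival s) / 2 + ival s * 1)) - 1) = one :> I.
      by apply: ival_inj; rewrite ival_one clampK; [lra|apply/andP; split; lra].
    rewrite fd; congr d2; apply: ival_inj; rewrite ival_zero; lra.
  by congr d2; apply: ival_inj; rewrite clampK; [lra|apply/andP; split; lra].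
Qed.

(** Both paths are images under [H] of boundary paths of the square from [(one, zero)] to
    [(one, one)]: one is a single side, the other runs along the three remaining sides. *)
Lemma free_homotopic_sides f g (H : I * I -> X) :
  continuous H -> (forall t, H (zero, t) = f t) -> (forall t, H (one, t) = g t) ->
  homotopic g (concat_fun (concat_fun (fun s => H (lerp s one zero, zero)) f)
                          (fun s => H (s, one))).
Proof.
move=> cH H0 H1.
pose a (s : I) : I * I := (lerp s one zero, zero).
pose b (s : I) : I * I := (zero, s).
pose c (s : I) : I * I := (s, one).
have ca : continuous a.
  apply: continuous_pair; last exact: cst_continuous.
  by apply: lerp_continuous; [move=> ?; exact: cvg_id|exact: cst_continuous..].
have cb : continuous b by exact: pairl_continuous.
have cc : continuous c by exact: pairr_continuous.
have -> : g = H \o (fun t => (one, t)) by apply/funext => t /=.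
have -> : concat_fun (concat_fun (fun s => H (lerp s one zero, zero)) f)
  (fun s => H (s, one)) = H \o concat_fun (concat_fun a b) c.
  apply/funext => t; rewrite /concat_fun /=; case: ifP => // _.
  by case: ifP => // _; rewrite -H0.
have ab : a one = b zero by rewrite /a lerp1.
have abc : concat_fun a b one = c zero by rewrite concat_fun1.
apply: square_homotopic => //; first exact: pairl_continuous.
- by apply: concat_fun_continuous => //; exact: concat_fun_continuous.
- by rewrite !concat_fun0 /a lerp0.
- by rewrite !concat_fun1.
Qed.

(** The collars [d1] and [d2] are retracted to get a homotopy; conversely, the traces of the two
    ends of a homotopy are the collars, the first one reversed. *)
Lemma Pi_boxP U V x y (f : {path I from x to y}) (h : continuousType I X) :
  U x -> V y -> Pi_box U V f (path_class h) <-> free_homotopic (U `*` V) f h.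
Proof.
move=> Ux Vy; split=> [[x' [y' [d1 [d2 [d1U d2V /path_classP]]]]]|].
  move=> /homotopic_sym hP.
  have fP : free_homotopic (U `*` V) f (concat (concat d1 f) d2).
    apply: free_homotopic_concat; rewrite ?path_zero ?path_one//;
      try exact: cts_fun.
    by move=> s; split; [apply: d1U; exists (lerp s one zero)|apply: d2V; exists s].
  apply: (free_homotopic_trans fP).
  by apply: homotopic_free hP; exact: free_homotopic_endsr fP.
move=> [H [cH H0 H1 HA]].
pose d1 (s : I) := H (lerp s one zero, zero); pose d2 (s : I) := H (s, one).
have cd1 : continuous d1.
  apply: comp_continuous cH; apply: continuous_pair; last exact: cst_continuous.
  by apply: lerp_continuous; [move=> ?; exact: cvg_id|exact: cst_continuous..].
have cd2 : continuous d2.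
  by apply: comp_continuous cH; exact: pairr_continuous.
have d11 : d1 one = x by rewrite /d1 lerp1 H0 path_zero.
have d20 : d2 zero = y by rewrite /d2 H0 path_one.
exists (h zero), (h one).
have d10 : d1 zero = h zero by rewrite /d1 lerp0 H1.
have d21 : d2 one = h one by rewrite /d2 H1.
exists (mk_path cd1 d10 d11), (mk_path cd2 d20 d21); split.
- by move=> _ [s _ <-]; exact: (HA _).1.
- by move=> _ [s _ <-]; exact: (HA _).2.
- by apply/path_classP; exact: free_homotopic_sides.
Qed.

(* Dragging the base point of [f] along the side of the square turns the given
   free null-homotopy into one relative to the base point. *)
Lemma free_null_homotopic f x :
  free_homotopic [set xx | xx.1 = xx.2] f (cst x) -> homotopic f (cst (f zero)).
Proof.
move=> [H [cH H0 H1 HA]].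
have H01 s : H (s, zero) = H (s, one) := HA s.
have [c [cc c0 c1 cE]] := three_sides_of_square R.
(* Along [c] the first coordinate suffices: [H] agrees on the two opposite sides and is constant on
   the side joining them. The path then runs along one side and back, and is contractible in the
   square. *)
have Hc : H \o c = H \o (fun t => ((c t).1, zero)).
  apply/funext => t /=; rewrite [c t]surjective_pairing /=.
  by case: (cE t) => [->|->|->]; rewrite ?H1 ?H01.
have -> : f = H \o (fun t => (zero, t)) by apply/funext => t /=.
apply: (@homotopic_trans _ _ (H \o c)).
  by apply: square_homotopic => //; rewrite ?c0 ?c1//; exact: pairl_continuous.
rewrite Hc.
have -> : cst ((H \o pair zero) zero) = H \o cst (zero, zero) by [].
apply: square_homotopic => //; rewrite ?c0 ?c1//; last exact: cst_continuous.
apply: continuous_pair; last exact: cst_continuous.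
by apply: comp_continuous cc _; exact: fst_continuous.
Qed.

(** The loop [f] followed by reversed [g] bounds a square on which [K] is constant along the other
    three sides. *)
Lemma simply_connected_homotopic f g : simply_connected R X ->
  continuous f -> continuous g -> f zero = g zero -> f one = g one ->
  homotopic f g.
Proof.
move=> [_ scX] cf cg fg0 fg1.
pose g' (t : I) := g (lerp t one zero).
have cg' : continuous g'.
  apply: (comp_continuous _ cg).
  by apply: lerp_continuous; [move=> ?; exact: cvg_id|exact: cst_continuous..].
have g'0 : g' zero = f one by rewrite /g' lerp0.
have g'1 : g' one = f zero by rewrite /g' lerp1.
pose q : {path I from f zero to f zero} :=
  concat (mk_path cf erefl erefl) (mk_path cg' g'0 g'1).
have [K [cK K0 K1 Kz Ko]] := scX _ q (@subsetT _ _).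
have {}Kz s : K (s, zero) = f zero by rewrite Kz path_zero.
have {}Ko s : K (s, one) = f zero by rewrite Ko path_one.
have {}K0 t : K (zero, t) = concat_fun f g' t by rewrite K0.
have half : ival (clamp 2^-1 : I) = 2^-1 by rewrite clampK//; apply/andP; split; lra.
have [c [cc c0 c1 cE]] := three_sides_of_square R.
(* Each stage follows the segment from a point [c s] of the three constant sides to the midpoint of
   the loop side, where [f] ends and reversed [g] begins. The first and last segments are the two
   halves of that side. *)
exists (fun st => K (lerp st.2 (c st.1).1 zero, lerp st.2 (c st.1).2 (clamp 2^-1))).
split=> [|t|t|s|s] /=.
- have c1' : continuous (fun st : I * I => c st.1).
    by apply: comp_continuous cc; exact: fst_continuous.
  apply: comp_continuous cK; apply: continuous_pair;
    (apply: lerp_continuous; [exact: snd_continuous| |exact: cst_continuous]);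
    apply: comp_continuous c1' _; [exact: fst_continuous|exact: snd_continuous].
- have /andP[t0 t1] := ival_itv t.
  rewrite c0 lerpxx K0 /concat_fun ival_lerp half ival_zero.
  rewrite ifT; last by lra.
  by congr f; apply: ival_inj; rewrite clampK; [lra|apply/andP; split; lra].
- have /andP[t0 t1] := ival_itv t.
  rewrite c1 lerpxx K0 /concat_fun ival_lerp half ival_one.
  case: ifPn => h.
    have -> : t = one by apply: ival_inj; rewrite ival_one; lra.
    rewrite -fg1; congr f; apply: ival_inj.
    by rewrite clampK ival_one; [lra|apply/andP; split; lra].
  congr g; apply: ival_inj.
  by rewrite ival_lerp ival_one ival_zero clampK; [lra|apply/andP; split; lra].
- rewrite !lerp0; case: (c s) (cE s) => c'1 c'2 /= [->|->|->]; by rewrite ?Kz ?Ko ?K1.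
- rewrite !lerp1 K0 /concat_fun half lexx.
  by congr f; apply: ival_inj; rewrite ival_one clampK; [lra|apply/andP; split; lra].
Qed.

(** Triviality at one base point spreads over a path connected set: conjugating by a path in [U]
    deforms a loop at [x'] through loops into a loop at [x]. *)
Lemma trivial_on_pi1_nice U x : open U -> U x -> path_connected R U ->
  trivial_on_pi1 R U x -> nice R U.
Proof.
move=> oU Ux pcU tU; split=> // x' Ux' f fU.
have [e eU] := pcU.2 _ _ Ux Ux'.
pose e' (s : I) := e (lerp s one zero).
have ce' : continuous e'.
  apply: (@comp_continuous _ _ _ (fun s => lerp s one zero)); last exact: cts_fun.
  by apply: lerp_continuous; [move=> ?; exact: cvg_id|exact: cst_continuous..].
have e'0 : e' zero = x' by rewrite /e' lerp0 path_one.
have e'1 : e' one = x by rewrite /e' lerp1 path_zero.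
suff: homotopic f (cst (f zero)) by rewrite path_zero.
apply: (@free_null_homotopic _ x).
pose p : {path I from x to x} := concat (concat e f) (mk_path ce' e'0 e'1).
apply: (@free_homotopic_trans _ p).
  apply: free_homotopic_concat; rewrite ?path_zero ?path_one//; exact: cts_fun.
apply: homotopic_free; first by rewrite /= path_zero path_one.
apply: (tU p) => _ [t _ <-].
rewrite (_ : (p : I -> X) t = concat_fun (concat_fun e f) e' t)// /concat_fun.
case: ifP => _; last by apply: eU; exists (lerp (clamp (2 * ival t - 1)) one zero).
by case: ifP => _; [apply: eU|apply: fU]; eexists.
Qed.

End free_homotopy.

Definition mk_continuous (T U : topologicalType) (f : T -> U)
    (cf : continuous f) : continuousType T U :=
  HB.pack f (isContinuous.Build T U f cf).

(** * Nice open sets form a basis *)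

Section nice_basis.
Context (R : realType) (X : topologicalType) (gX : good_space R X).

Lemma nice_nbhs (x : X) (W : set X) :
  nbhs x W -> exists U, [/\ nice R U, U x & U `<=` W].
Proof.
move=> xW; have [_ lpc slsc] := gX.
have [U0 [oU0 U0x tU0]] := slsc x.
(* Inside [U0] the loops at [x] are already null-homotopic in [X], and this persists on the smaller
   path connected set. *)
have [U [oU Ux pcU UW]] : exists U,
    [/\ open U, U x, path_connected R U & U `<=` U0 `&` W].
  by apply: lpc; apply: filterI => //; exact: open_nbhs_nbhs.
exists U; split=> //; last by move=> z /UW[].
apply: (trivial_on_pi1_nice oU Ux) => // f fU.
by apply: tU0 => z /fU /UW[].
Qed.

End nice_basis.

(** * The topology of Pi(X) *)

Section path_classes.
Context (R : realType) (X : topologicalType).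
Local Notation I := (unit_interval R).

Definition cls (f : I -> X) (cf : continuous f) : Pi R X :=
  path_class (mk_path cf erefl erefl).

Lemma cls_eq f g (cf : continuous f) (cg : continuous g) :
  cls cf = cls cg <-> homotopic f g.
Proof. exact: path_classP. Qed.

Lemma path_class_cls (f : continuousType I X) : path_class f = cls (@cts_fun _ _ f).
Proof. by apply/path_classP; apply: homotopic_refl; exact: cts_fun. Qed.

Lemma cls_repr (c : Pi R X) : cls (@cts_fun _ _ (repr c)) = c.
Proof. by rewrite -path_class_cls /path_class reprK. Qed.

Lemma repr_cls f (cf : continuous f) : homotopic (repr (cls cf)) f.
Proof. by apply/(cls_eq (@cts_fun _ _ _) cf); rewrite cls_repr. Qed.

Lemma Pi_ind (P : Pi R X -> Prop) :
  (forall f (cf : continuous f), P (cls cf)) -> forall c, P c.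
Proof. by move=> Pf c; rewrite -(cls_repr c). Qed.

(** A homotopy of representatives fixes the ends, so conditions on a class can be stated for [repr]
    and checked on any representative. *)
Lemma free_homotopic_repr A f g (cg : continuous g) :
  free_homotopic A f (repr (cls cg)) <-> free_homotopic A f g.
Proof.
split=> fg; apply: (free_homotopic_trans fg); apply: homotopic_free.
- exact: free_homotopic_endsr fg.
- exact: repr_cls.
- exact: free_homotopic_endsr fg.
- exact/homotopic_sym/repr_cls.
Qed.

Definition src (c : Pi R X) : X := repr c zero.
Definition tgt (c : Pi R X) : X := repr c one.

Lemma src_cls f (cf : continuous f) : src (cls cf) = f zero.
Proof. exact: (homotopic_ends (repr_cls cf)).1. Qed.

Lemma tgt_cls f (cf : continuous f) : tgt (cls cf) = f one.
Proof. exact: (homotopic_ends (repr_cls cf)).2. Qed.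

Context (gX : good_space R X).

(** This describes neighbourhoods by boxes centred at the class itself and bounded by arbitrary open
    sets; the work lies in passing from the subbase, whose boxes have other centres. *)
Lemma nbhs_cls f (cf : continuous f) (N : set (Pi R X)) :
  nbhs (cls cf) N <->
  exists U V, [/\ open U, open V, U (f zero), V (f one) &
    forall g (cg : continuous g), free_homotopic (U `*` V) f g -> N (cls cg)].
Proof.
split=> [|[U [V [oU oV Uf Vf UVN]]]]; last first.
  have [U' [nU' U'f U'U]] := nice_nbhs gX (open_nbhs_nbhs (conj oU Uf)).
  have [V' [nV' V'f V'V]] := nice_nbhs gX (open_nbhs_nbhs (conj oV Vf)).
  pose fp : {path I from f zero to f one} := mk_path cf erefl erefl.
  pose B := Pi_box U' V' fp.
  exists B; split.
  - exists [set B]; last by rewrite bigcup_set1.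
    move=> _ ->; exists (fset1 B); last by rewrite set_fset1 bigcap_set1.
    by move=> ? /[!inE] ->; exists U', V', (f zero), (f one), fp.
  - apply/(Pi_boxP fp _ U'f V'f); exact: free_homotopic_refl.
  - elim/Pi_ind => g cg /(Pi_boxP fp _ U'f V'f) fg; apply: UVN.
    by apply: free_homotopicS fg => -[? ?] [? ?]; split; [exact: U'U|exact: V'V].
pose D := [set UV : set X * set X |
  [/\ open UV.1, open UV.2, UV.1 (f zero) & UV.2 (f one)]].
pose F := filter_from D (fun UV =>
  [set c : Pi R X | free_homotopic (UV.1 `*` UV.2) f (repr c)]).
(* The filter property absorbs the finite intersections of the generated topology, leaving a single
   subbasic box to treat. *)
have FF : Filter F.
  apply: filter_from_filter; first by exists (setT, setT); split=> //; exact: openT.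
  move=> [U V] [U' V'] [/= oU oV Uf Vf] [/= oU' oV' Uf' Vf'].
  exists (U `&` U', V `&` V'); first by split=> //; exact: openI.
  move=> c /= fc; split; apply: free_homotopicS fc => -[? ?] [[? ?] [? ?]] //.
suff FN : nbhs (cls cf) N -> F N.
  move=> /FN[[U V] [/= oU oV Uf Vf] UVN]; exists U, V; split=> // g cg fg.
  apply: UVN; exact/free_homotopic_repr.
move=> [_ [[D' D'fin <-] [E D'E Ef] EN]].
apply: filterS EN _; apply: (@filterS _ _ _ E); first by move=> c Ec; exists E.
have /D'fin[Fs FsB FsE] := D'E; rewrite -FsE; apply: filter_bigI => B BF.
have /set_mem[U [V [x [y [f0 [nU nV Ux Vy BE]]]]]] := FsB _ BF.
have Bf : B (cls cf) by move: Ef; rewrite -FsE; apply.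
(* The box is recentred: what is near [f] is near [f0] by transitivity. *)
have f0f : free_homotopic (U `*` V) f0 f.
  by apply/(Pi_boxP f0 (mk_path cf erefl erefl) Ux Vy); rewrite -BE.
have [/= Uf Vf] := free_homotopic_endsr f0f.
exists (U, V); first by split=> //=; [case: nU|case: nV].
elim/Pi_ind => g cg /= /free_homotopic_repr fg; rewrite BE; apply/Pi_boxP => //=.
exact: free_homotopic_trans fg.
Qed.

Lemma open_box (U V : set X) (f : I -> X) : open U -> open V ->
  open [set c : Pi R X | free_homotopic (U `*` V) f (repr c)].
Proof.
move=> oU oV; rewrite openE; elim/Pi_ind => g cg /= /free_homotopic_repr fg.
apply/nbhs_cls; have [Ug Vg] := free_homotopic_endsr fg.
exists U, V; split=> // h ch gh; apply/free_homotopic_repr.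
exact: free_homotopic_trans gh.
Qed.

Lemma src_continuous : continuous src.
Proof.
elim/Pi_ind => f cf N /=; rewrite src_cls nbhsE => -[U [oU Uf] UN].
apply/nbhs_cls; exists U, setT; split=> // [|g cg fg]; first exact: openT.
by apply: UN; rewrite src_cls; case: (free_homotopic_endsr fg).
Qed.

Lemma tgt_continuous : continuous tgt.
Proof.
elim/Pi_ind => f cf N /=; rewrite tgt_cls nbhsE => -[U [oU Uf] UN].
apply/nbhs_cls; exists setT, U; split=> // [|g cg fg]; first exact: openT.
by apply: UN; rewrite tgt_cls; case: (free_homotopic_endsr fg).
Qed.

Lemma cst_cls_continuous :
  continuous (fun x : X => cls (@cst_continuous I X x)).
Proof.
move=> x N /nbhs_cls[U [V [oU oV Ux Vx UVN]]].
have xUV : nbhs x (U `&` V) by apply: filterI; exact: open_nbhs_nbhs.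
have [W [[oW pcW _] Wx WUV]] := nice_nbhs gX xUV.
apply: filterS (open_nbhs_nbhs (conj oW Wx)) => y Wy /=.
have [e eW] := pcW.2 _ _ Wx Wy.
(* The constant path is carried along [e] through constant paths, so both ends move together inside
   [W]. *)
apply: UVN; exists (fun st => e st.1); split=> /= [|t|t|s].
- by apply: (@comp_continuous _ _ _ fst e); [exact: fst_continuous|exact: cts_fun].
- by rewrite path_zero.
- by rewrite path_one.
- by apply: WUV; apply: eW; exists s.
Qed.

End path_classes.

(** * The map induced on path classes *)

Section Pi_functor.
Context (R : realType) (X Y : topologicalType).
Local Notation I := (unit_interval R).
Implicit Types p : continuousType Y X.

Lemma Pi_map_cls p f (cf : continuous f) :
  Pi_map R p (cls cf) = cls (comp_continuous cf (@cts_fun _ _ p)).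
Proof.
rewrite Pi_mapE path_class_cls.
by apply/cls_eq/homotopic_refl/comp_continuous/cts_fun.
Qed.

Lemma Pi_map_cls_eq p f (cf : continuous f) h (ch : continuous h) :
  (forall t, p (f t) = h t) -> Pi_map R p (cls cf) = cls ch.
Proof.
move=> pf; rewrite Pi_map_cls; apply/cls_eq.
by rewrite (_ : (fun _ => _) = h); [exact: homotopic_refl|exact/funext].
Qed.

Lemma src_Pi_map p c : src (Pi_map R p c) = p (src c).
Proof. by elim/Pi_ind: c => f cf; rewrite Pi_map_cls !src_cls. Qed.

Lemma free_homotopic_comp p A (f g : I -> Y) :
  free_homotopic [set yy | A (p yy.1, p yy.2)] f g ->
  free_homotopic A (p \o f) (p \o g).
Proof.
move=> [H [cH H0 H1 HA]]; exists (p \o H); split=> [|t|t|s] /=.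
- by apply: comp_continuous cH _; exact: cts_fun.
- by rewrite H0.
- by rewrite H1.
- exact: HA.
Qed.

Lemma Pi_map_continuous p :
  good_space R X -> good_space R Y -> continuous (Pi_map R p).
Proof.
move=> gX gY; elim/Pi_ind => f cf N; rewrite /= Pi_map_cls.
move=> /(nbhs_cls gX)[U [V [oU oV Uf Vf UVN]]]; apply/(nbhs_cls gY).
have cp : continuous p by exact: cts_fun.
exists (p @^-1` U), (p @^-1` V); split=> // [||g cg fg].
- by apply: open_comp => // y _; exact: cp.
- by apply: open_comp => // y _; exact: cp.
- rewrite /= Pi_map_cls; apply: UVN; apply: free_homotopic_comp.
  by apply: free_homotopicS fg => -[].
Qed.

End Pi_functor.

(** * Minimum and maximum on the unit interval *)

Section imin.
Context (R : realType).
Local Notation I := (unit_interval R).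

Definition imin (s t : I) : I := clamp (Num.min (ival s) (ival t)).
Definition imax (s t : I) : I := clamp (Num.max (ival s) (ival t)).

Lemma ival_imin s t : ival (imin s t) = Num.min (ival s) (ival t).
Proof.
have /andP[s0 s1] := ival_itv s; have /andP[t0 t1] := ival_itv t.
by rewrite clampK// le_min s0 t0 ge_min s1.
Qed.

Lemma ival_imax s t : ival (imax s t) = Num.max (ival s) (ival t).
Proof.
have /andP[s0 s1] := ival_itv s; have /andP[t0 t1] := ival_itv t.
by rewrite clampK// le_max s0 ge_max s1 t1.
Qed.

Lemma imin_continuous t : continuous (imin^~ t).
Proof.
apply: comp_clamp_continuous => s.
apply: (@continuous_min R I (@ival R) (cst (ival t))).
  exact: ival_continuous.
exact: cst_continuous.
Qed.

Lemma imax_continuous t : continuous (imax t).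
Proof.
apply: comp_clamp_continuous => s.
apply: (@continuous_max R I (cst (ival t)) (@ival R)).
  exact: cst_continuous.
exact: ival_continuous.
Qed.

End imin.

(** * Lifting along a covering map *)

Section sheets.
Context (Y X : topologicalType) (p : Y -> X).

(** A pointwise form of [restricts_to_homeo]: since [U] will be open, continuity of the section can
    be asked at each point, without subspace topologies. *)
Definition sheet (U : set X) (V : set Y) (g : X -> Y) : Prop :=
  [/\ open V, forall x, U x -> V (g x) /\ p (g x) = x,
      forall y, V y -> U (p y) /\ g (p y) = y &
      forall x, U x -> {for x, continuous g}].

Lemma evenly_covered_sheet U F V : open U ->
  (forall V, F V -> open V /\ restricts_to_homeo p V U) -> F V ->
  exists g, sheet U V g.
Proof.
move=> oU Fh /Fh[oV [g [_ cg pVU gUV [pK gK]]]]; exists g; split=> //.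
- by move=> x Ux; split; [exact: gUV|apply: gK; rewrite inE].
- by move=> y Vy; split; [exact: pVU|apply: pK; rewrite inE].
- move=> x Ux; move: cg; rewrite continuous_open_subspace// => /(_ x); apply.
  by rewrite inE.
Qed.

Context (cp : covering_map p).

Lemma covering_continuous : continuous p.
Proof. by case: cp. Qed.

Lemma covering_sheet x : exists U, [/\ open U, U x &
  forall y, U (p y) -> exists V g, sheet U V g /\ V y].
Proof.
have [_ _ /(_ x)[U [oU Ux [F [_ Fcov Fh]]]]] := cp.
exists U; split=> // y Upy.
have : (p @^-1` U) y by [].
rewrite -Fcov => -[V FV Vy]; have [g gs] := evenly_covered_sheet oU Fh FV.
by exists V, g.
Qed.

(** A sheet meets a fibre at most once, so distinct points of a fibre lie in distinct, hence
    disjoint, sheets. *)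
Lemma covering_separated y y' : p y = p y' -> y <> y' ->
  exists V V', [/\ open V, open V', V y, V' y' & V `&` V' = set0].
Proof.
move=> pyy' yy'.
have [_ _ /(_ (p y))[U [oU Ux [F [tF Fcov Fh]]]]] := cp.
have : (p @^-1` U) y by [].
rewrite -Fcov => -[V FV Vy]; have [g [oV _ gpV _]] := evenly_covered_sheet oU Fh FV.
have : (p @^-1` U) y' by rewrite /preimage /= -pyy'.
rewrite -Fcov => -[V' FV' Vy']; exists V, V'; split=> //; first exact: (Fh _ FV').1.
have [//|/set0P VV'] := eqVneq (V `&` V') set0.
have VV := tF _ _ FV FV' VV'; rewrite -VV in Vy'.
by exfalso; apply: yy'; rewrite -(gpV _ Vy).2 pyy' (gpV _ Vy').2.
Qed.

End sheets.

Section lifting.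
Context (R : realType) (Y X : topologicalType) (p : Y -> X).
Local Notation I := (unit_interval R).
Context (cp : covering_map p).

(** Agreement is locally constant: near an agreement both lifts lie in one sheet, where [p] is
    injective; near a disagreement they lie in disjoint sheets. *)
Lemma unique_lift (f g : I -> Y) s0 : continuous f -> continuous g ->
  (forall t, p (f t) = p (g t)) -> f s0 = g s0 -> forall t, f t = g t.
Proof.
move=> cf cg fg; apply: unit_interval_ind => s.
have [fgs|fgs] := pselect (f s = g s).
  have [U [oU Ufs Usheet]] := covering_sheet cp (p (f s)).
  have [V [h [[oV _ hV _] Vfs]]] := Usheet _ Ufs.
  exists (f @^-1` V `&` g @^-1` V).
    apply: filterI; first by apply: cf; exact: open_nbhs_nbhs.
    by apply: cg; apply: open_nbhs_nbhs; split; rewrite // -fgs.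
  move=> t u _ [Vfu Vgu] _.
  by rewrite -(hV _ Vfu).2 fg (hV _ Vgu).2.
have [V [V' [oV oV' Vf Vg VV']]] := covering_separated cp (fg s) fgs.
exists (f @^-1` V `&` g @^-1` V').
  by apply: filterI; [apply: cf|apply: cg]; exact: open_nbhs_nbhs.
move=> t u [Vft Vgt] _ fgt; suff : set0 (f t) by [].
by rewrite -VV'; split=> //; rewrite fgt.
Qed.

(** The section applied to the projection of [a] is a second lift, agreeing with [a] at [s0]. *)
Lemma lift_in_sheet U V g (a : I -> Y) s0 : sheet p U V g -> continuous a ->
  (forall t, U (p (a t))) -> V (a s0) -> forall t, a t = g (p (a t)).
Proof.
move=> [oV gU gV cg] ca Ua Va; apply: (unique_lift (s0 := s0)) => //.
- move=> t; apply: (@continuous_comp _ _ _ (p \o a) g).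
    exact: comp_continuous ca (covering_continuous cp) t.
  by apply: cg; exact: Ua.
- by move=> t; rewrite (gU _ (Ua t)).2.
- by rewrite (gV _ Va).2.
Qed.

Lemma lift_stays U V g (a : I -> Y) s0 : sheet p U V g -> continuous a ->
  (forall t, U (p (a t))) -> V (a s0) -> forall t, V (a t).
Proof.
move=> sg ca Ua Va t; rewrite (lift_in_sheet sg ca Ua Va t).
by case: sg => _ gU _ _; exact: (gU _ _).1.
Qed.

Lemma path_lift (f : I -> X) y : continuous f -> p y = f zero ->
  exists a : I -> Y, [/\ continuous a, forall t, p (a t) = f t & a zero = y].
Proof.
move=> cf py.
(* Partial lifts are replaced by total lifts of the path frozen after time [s]. *)
pose P s := exists a : I -> Y,
  [/\ continuous a, forall t, p (a t) = f (imin t s) & a zero = y].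
suff /(_ one)[a [ca pa a0]] : forall s, P s.
  exists a; split=> // t; rewrite pa; congr f; apply: ival_inj.
  by rewrite ival_imin ival_one; apply/min_idPl; case/andP: (ival_itv t).
apply: (@unit_interval_ind _ _ zero); last first.
  exists (cst y); split=> //; first exact: cst_continuous.
  move=> t; rewrite py; congr f; apply: ival_inj.
  by rewrite ival_imin ival_zero; apply/esym/min_idPr; case/andP: (ival_itv t).
move=> s; have [U [oU Us Usheet]] := covering_sheet cp (f s).
have [e e0 eU] := nbhs_ivalP (cf s _ (open_nbhs_nbhs (conj oU Us))).
exists [set t | `|ival t - ival s| < e]; first exact: nbhs_ival.
move=> t u /= te ue [a [ca pa a0]].
have [ut|tu] := lerP (ival u) (ival t).
  exists (fun w => a (imin w u)); split.
  - by apply: comp_continuous ca; exact: imin_continuous.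
  - move=> w; rewrite pa; congr f; apply: ival_inj; rewrite !ival_imin.
    by rewrite -minA (min_idPl ut).
  - rewrite -[RHS]a0; congr a; apply: ival_inj; rewrite ival_imin ival_zero.
    by apply/min_idPl; case/andP: (ival_itv u).
have pat : p (a t) = f t.
  by rewrite pa; congr f; apply: ival_inj; rewrite ival_imin minxx.
have [V [g [[oV gU gV cg] Vat]]] : exists V g, sheet p U V g /\ V (a t).
  by apply: Usheet; rewrite pat; exact: eU.
(* Confining [w] between [t] and [u] keeps [f (m w)] in [U] for every [w], so the branch given by
   the section is continuous on the whole interval, as gluing requires. *)
pose m w := imax t (imin w u).
have Um w : U (f (m w)).
  apply: eU; rewrite /m ival_imax ival_imin; move: te ue.
  rewrite !ltr_norml => /andP[t1 t2] /andP[u1 u2].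
  apply/andP; split.
    by rewrite (lt_le_trans t1)// lerB// le_max lexx.
  rewrite ltrBlDr gt_max -ltrBlDr t2 /= gt_min; apply/orP; right.
  by rewrite -ltrBlDr.
exists (fun w => if ival w <= ival t then a w else g (f (m w))); split.
- apply: continuous_if_le => //; first exact: ival_continuous.
    move=> w; apply: (@continuous_comp _ _ _ (f \o m) g); last by apply: cg; exact: Um.
    apply: (comp_continuous _ cf); apply: comp_continuous.
      exact: imin_continuous.
    exact: imax_continuous.
  move=> w wt; rewrite (ival_inj wt) -[LHS](gV _ Vat).2 pat; congr (g (f _)).
  apply: ival_inj; rewrite ival_imax ival_imin (min_idPl (ltW tu)).
  by rewrite maxxx.
- move=> w; case: ifPn => wt.
    rewrite pa; congr f; apply: ival_inj; rewrite !ival_imin (min_idPl wt).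
    by apply/esym/min_idPl; exact: le_trans (ltW tu).
  rewrite (gU _ (Um w)).2; congr f; apply: ival_inj; rewrite ival_imax.
  apply/max_idPr; rewrite ival_imin le_min (ltW tu) andbT.
  by rewrite ltW// ltNge.
- by rewrite ival_zero ifT//; case/andP: (ival_itv t).
Qed.

(** Each path in the homotopy direction is lifted separately; only joint continuity is at stake. As
    continuity in [t] at one time propagates to nearby times, [T] may be arbitrary. *)
Lemma homotopy_lift (T : topologicalType) (H : I * T -> X) (a : T -> Y) :
  continuous H -> continuous a -> (forall t, p (a t) = H (zero, t)) ->
  exists G : I * T -> Y, [/\ continuous G, forall st, p (G st) = H st &
    forall t, G (zero, t) = a t].
Proof.
move=> cH ca pa.
have /choice[L Lp] : forall t, exists l : I -> Y,
    [/\ continuous l, forall s, p (l s) = H (s, t) & l zero = a t].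
  move=> t; apply: path_lift => //.
  by apply: comp_continuous cH; exact: pairr_continuous.
have cL t : continuous (L t) by case: (Lp t).
have pL t s : p (L t s) = H (s, t) by case: (Lp t) => _ ->.
(* Continuity at a single time [s] puts the lifts for all [t] near [t0] in one sheet; they stay
   there for times near [s0], so [L] equals the section applied to [H]. *)
have local (s0 : I) t0 : exists e, 0 < e /\ forall s,
    `|ival s - ival s0| < e -> {for t0, continuous (L^~ s)} ->
    exists g M, [/\ nbhs t0 M, forall u, `|ival u - ival s0| < e ->
      {for H (u, t0), continuous g} &
      forall u t, `|ival u - ival s0| < e -> M t -> L t u = g (H (u, t))].
  have [U [oU Us Usheet]] := covering_sheet cp (H (s0, t0)).
  have [[N M] /= [Ns Mt] NMU] := cH _ _ (open_nbhs_nbhs (conj oU Us)).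
  have {NMU}NMU u t : N u -> M t -> U (H (u, t)).
    by move=> Nu Mt'; exact: (NMU (u, t)).
  have [e e0 eN] := nbhs_ivalP Ns; exists e; split=> // s se cs.
  have [V [g [sg VL]]] : exists V g, sheet p U V g /\ V (L t0 s).
    by apply: Usheet; rewrite pL; apply: NMU; [exact: eN|exact: nbhs_singleton].
  have [oV _ _ cg] := sg.
  exists g, (M `&` (L^~ s) @^-1` V); split=> [|u ue|u t ue [Mt' Vt]].
  - by apply: filterI => //; apply: cs; exact: open_nbhs_nbhs.
  - by apply: cg; apply: NMU; [exact: eN|exact: nbhs_singleton].
  - have := @lift_in_sheet U V g (fun w => L t (lerp w s u)) zero sg.
    rewrite lerp0 => /(_ _ _ Vt one); rewrite lerp1 pL; apply.
      apply: comp_continuous (cL t); apply: lerp_continuous; last 2 first.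
      - exact: cst_continuous.
      - exact: cst_continuous.
      - by move=> ?; exact: cvg_id.
    by move=> w; rewrite pL; apply: NMU => //; apply/eN/lerp_ball.
(* Continuity at [t0] spreads from time zero, where [L] is [a], to all times. *)
have cLs t0 s : {for t0, continuous (L^~ s)}.
  move: s; apply: (@unit_interval_ind _ _ zero); last first.
    rewrite (_ : L^~ zero = a); first exact: ca.
    by apply/funext => t; case: (Lp t).
  move=> s0; have [e [e0 loc]] := local s0 t0.
  exists [set s | `|ival s - ival s0| < e]; first exact: nbhs_ival.
  move=> s u /= se ue /(loc _ se)[g [M [Mt cg LM]]].
  have cgH : {for t0, continuous (fun t => g (H (u, t)))}.
    apply: (@continuous_comp _ _ _ (fun t => H (u, t)) g); last exact: cg.
    by apply: comp_continuous cH _; exact: pairl_continuous.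
  rewrite /prop_for /= /continuous_at (LM u t0 ue (nbhs_singleton Mt)).
  apply: cvg_trans cgH; apply: near_eq_cvg.
  by apply: filterS Mt => t Mt; rewrite LM.
exists (fun st => L st.2 st.1); split=> [[s0 t0]|[s t]|t] /=; last 2 first.
- exact: pL.
- by case: (Lp t).
have [e [e0 loc]] := local s0 t0.
have s0e : `|ival s0 - ival s0| < e by rewrite subrr normr0.
have [g [M [Mt cg LM]]] := loc _ s0e (cLs t0 s0).
have cgH : {for (s0, t0), continuous (g \o H)}.
  by apply: continuous_comp; [exact: cH|exact: cg].
rewrite /continuous_at /= (LM s0 t0 s0e (nbhs_singleton Mt)).
apply: cvg_trans cgH; apply: near_eq_cvg.
exists ([set s | `|ival s - ival s0| < e], M) => /=.
  by split=> //; exact: nbhs_ival.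
by move=> [s t] /= [se Mt']; rewrite LM.
Qed.

(** The side paths of the lifted homotopy project to constants, hence are constant; its last stage
    lifts [p \o b] from the start of [b], so it is [b]. *)
Lemma homotopic_lift (a b : I -> Y) : continuous a -> continuous b ->
  a zero = b zero -> homotopic (p \o a) (p \o b) -> homotopic a b.
Proof.
move=> ca cb ab [H [cH H0 H1 Hz Ho]].
have [G [cG pG G0]] := homotopy_lift cH ca (fun t => esym (H0 t)).
have side w : (forall s, H (s, w) = H (zero, w)) -> forall s, G (s, w) = a w.
  move=> Hw; apply: (unique_lift (s0 := zero)) => //.
  - by apply: comp_continuous cG; exact: pairr_continuous.
  - exact: cst_continuous.
  - by move=> s; rewrite pG Hw H0.
exists G; split=> //.
- apply: (unique_lift (s0 := zero)) => //.
  + by apply: comp_continuous cG; exact: pairl_continuous.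
  + by move=> t; rewrite pG H1.
  + by rewrite side// => s; rewrite Hz H0.
- by apply: side => s; rewrite Hz H0.
- by apply: side => s; rewrite Ho H0.
Qed.

(** The traces of the ends of the lifted homotopy cannot leave their sheets. This makes a box
    upstairs map onto the box below, both for openness and for even covering. *)
Lemma free_homotopic_lift U V g U' V' g' (a : I -> Y) (h : I -> X) :
  sheet p U V g -> sheet p U' V' g' -> continuous a -> V (a zero) -> V' (a one) ->
  free_homotopic (U `*` U') (p \o a) h ->
  exists b, [/\ continuous b, forall t, p (b t) = h t &
    free_homotopic (V `*` V') a b].
Proof.
move=> sg sg' ca Va Va' [H [cH H0 H1 HU]].
have [G [cG pG G0]] := homotopy_lift cH ca (fun t => esym (H0 t)).
have cGs w : continuous (fun s => G (s, w)).
  by apply: comp_continuous cG; exact: pairr_continuous.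
exists (fun t => G (one, t)); split.
- by apply: comp_continuous cG; exact: pairl_continuous.
- by move=> t; rewrite pG H1.
- exists G; split=> // s; split=> /=.
    apply: (lift_stays (s0 := zero) sg (cGs zero)); last by rewrite G0.
    by move=> t; rewrite pG; case: (HU t).
  apply: (lift_stays (s0 := zero) sg' (cGs one)); last by rewrite G0.
  by move=> t; rewrite pG; case: (HU t).
Qed.

End lifting.

(** * Open injective restrictions and small sheets *)

Section open_maps.
Context (Y X : topologicalType) (p : Y -> X).

Lemma open_injective_restricts_to_homeo (V : set Y) (U : set X) (y0 : Y) :
  V y0 -> open V -> continuous p ->
  (forall y N, nbhs y N -> nbhs (p y) (p @` N)) ->
  {in V &, injective p} -> p @` V = U -> restricts_to_homeo p V U.
Proof.
move=> Vy0 oV cp op pI pVU.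
(* The choice of inverse must be total; [y0] is its value off [U]. *)
have /choice[g gP] : forall x, exists y, U x -> V y /\ p y = x.
  move=> x; have [|nUx] := pselect (U x); last by exists y0.
  by rewrite -pVU => -[y Vy yx]; exists y.
have gp y : V y -> g (p y) = y.
  move=> Vy; have Up : U (p y) by rewrite -pVU; exists y.
  by have [Vg pg] := gP _ Up; apply: pI; rewrite ?inE.
have oU : open U.
  rewrite openE => x; rewrite -{1}pVU => -[y Vy <-]; rewrite -pVU.
  by apply: op; exact: open_nbhs_nbhs.
exists g; split.
- exact: continuous_subspaceT.
- rewrite continuous_open_subspace// => x; rewrite inE -pVU => -[y Vy <-] N.
  rewrite /= gp// => yN; have : nbhs y (N `&` V).
    by apply: filterI => //; exact: open_nbhs_nbhs.
  by move=> /op; apply: filterS => _ [z [Nz Vz] <-]; rewrite /= gp.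
- by move=> y Vy; rewrite -pVU; exists y.
- by move=> x /gP[].
- split=> [y|x]; rewrite inE; [exact: gp|].
  by move=> /gP[].
Qed.

Lemma small_sheet (y : Y) (W : set Y) : covering_map p -> open W -> W y ->
  exists U V g, [/\ open U, sheet p U V g, V y & V `<=` W].
Proof.
move=> cp oW Wy; have [U [oU Uy Usheet]] := covering_sheet cp (p y).
have [V [g [[oV gU gV cg] Vy]]] := Usheet _ Uy.
exists (U `&` g @^-1` W), (V `&` W), g; split=> //.
- move: W oW {Wy}; apply/(continuous_inP g oU) => x.
  by rewrite inE; exact: cg.
- split=> [|x [Ux Wx]|z [Vz Wz]|x [Ux _]].
  + exact: openI.
  + by have [Vg pg] := gU _ Ux.
  + by have [Up gp] := gV _ Vz; rewrite /= gp.
  + exact: cg.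
Qed.

End open_maps.

(** * The covering Pi(Y) -> Pi(X) *)

Section Pi_covering.
Context (R : realType) (X Y : topologicalType) (p : continuousType Y X).
Local Notation I := (unit_interval R).
Context (gX : good_space R X) (gY : good_space R Y) (cp : covering_map p).

Lemma Pi_map_open c (N : set (Pi R Y)) :
  nbhs c N -> nbhs (Pi_map R p c) (Pi_map R p @` N).
Proof.
elim/Pi_ind: c => f cf; rewrite Pi_map_cls => /(nbhs_cls gY).
move=> [U [V [oU oV Uf Vf UVN]]]; apply/(nbhs_cls gX).
have [A [U' [g [oA sg U'f U'U]]]] := small_sheet cp oU Uf.
have [B [V' [g' [oB sg' V'f V'V]]]] := small_sheet cp oV Vf.
exists A, B; split=> // [||h ch fh].
- by case: sg => _ _ gV _; exact: (gV _ U'f).1.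
- by case: sg' => _ _ gV _; exact: (gV _ V'f).1.
have [b [cb pb fb]] := free_homotopic_lift cp sg sg' cf U'f V'f fh.
exists (cls cb).
  by apply: UVN; apply: free_homotopicS fb => -[? ?] [? ?]; split; [exact: U'U|exact: V'V].
exact: Pi_map_cls_eq.
Qed.

Lemma Pi_map_surj : set_surj setT setT (Pi_map R p).
Proof.
elim/Pi_ind => h ch _; have [_ ps _] := cp.
have [y _ py] := ps (h zero) Logic.I.
have [a [ca pa _]] := path_lift cp ch py.
by exists (cls ca) => //; exact: Pi_map_cls_eq.
Qed.

Lemma Pi_map_evenly_covered h (ch : continuous h) : exists W : set (Pi R X),
  [/\ open W, W (cls ch) & evenly_covered (Pi_map R p) W].
Proof.
have [_ _ ec] := cp.
have [U [oU Uh [F [tF Fcov Fh]]]] := ec (h zero).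
have [V [oV Vh [G [tG Gcov Gh]]]] := ec (h one).
have Fsheet A : F A -> exists g, sheet p U A g by exact: evenly_covered_sheet.
have Gsheet B : G B -> exists g, sheet p V B g by exact: evenly_covered_sheet.
pose W : set (Pi R X) := [set c : Pi R X | free_homotopic (U `*` V) h (repr c)].
exists W; split; first exact: open_box.
  by apply/free_homotopic_repr; exact: free_homotopic_refl.
pose S (a : I -> Y) A B :=
  [set c : Pi R Y | free_homotopic (A `*` B) a (repr c)].
(* One sheet for each lift of [h], bounded by the sheets of [p] that contain its ends. *)
pose FW := [set D | exists a A B, [/\ continuous a, (forall t, p (a t) = h t),
  F A, G B & A (a zero) /\ B (a one) /\ D = S a A B]].
have W_lift a A B : continuous a -> (forall t, p (a t) = h t) -> F A -> G B ->
    forall c, S a A B c -> W (Pi_map R p c).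
  move=> ca pa FA GB; elim/Pi_ind => f cf /free_homotopic_repr af.
  rewrite Pi_map_cls /W; apply/free_homotopic_repr.
  have -> : h = p \o a by apply/funext => t; rewrite -pa.
  apply: free_homotopic_comp; apply: free_homotopicS af => -[y y'] [/= Ay By'].
  have [g [_ _ gA _]] := Fsheet _ FA; have [g' [_ _ gB _]] := Gsheet _ GB.
  by split=> /=; [exact: (gA _ Ay).1|exact: (gB _ By').1].
exists FW; split.
- move=> D1 D2 [a1 [A1 [B1 [ca1 pa1 FA1 GB1 [Aa1 [Ba1 D1E]]]]]].
  move=> [a2 [A2 [B2 [ca2 pa2 FA2 GB2 [Aa2 [Ba2 D2E]]]]]] [c [/= D1c D2c]].
  rewrite D1E D2E in D1c D2c *.
  have [/= A1c B1c] := free_homotopic_endsr D1c.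
  have [/= A2c B2c] := free_homotopic_endsr D2c.
  (* A common class has its ends in both pairs of sheets, so the pairs coincide; the two lifts of
     [h] then start at the same point. *)
  have A12 : A1 = A2 by apply: tF => //; exists (repr c zero).
  have B12 : B1 = B2 by apply: tG => //; exists (repr c one).
  suff a12 : a1 = a2 by rewrite a12 A12 B12.
  rewrite -{}A12 in Aa2; apply/funext.
  apply: (unique_lift cp (s0 := zero)) => //; first by move=> t; rewrite pa1 pa2.
  have [g [_ _ gA _]] := Fsheet _ FA1.
  by rewrite -(gA _ Aa1).2 pa1 -pa2 (gA _ Aa2).2.
- apply/seteqP; split=> [c [D [a [A [B [ca pa FA GB [_ [_ ->]]]]]]]|].
    exact: W_lift.
  elim/Pi_ind => f cf; rewrite /preimage /= Pi_map_cls => /free_homotopic_repr.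
  move=> /[dup] /free_homotopic_endsr[/= Uf Vf] /free_homotopic_sym fh.
  have : (p @^-1` U) (f zero) by []. rewrite -Fcov => -[A FA Af].
  have : (p @^-1` V) (f one) by []. rewrite -Gcov => -[B GB Bf].
  have [g sg] := Fsheet _ FA; have [g' sg'] := Gsheet _ GB.
  (* The homotopy is run from [p \o f] to [h]: lifted from [f], it ends at the required lift of
     [h]. *)
  have [a [ca pa fa]] := free_homotopic_lift cp sg sg' cf Af Bf fh.
  have [/= Aa Ba] := free_homotopic_endsr fa.
  exists (S a A B); first by exists a, A, B.
  by apply/free_homotopic_repr; exact: free_homotopic_sym.
- move=> D [a [A [B [ca pa FA GB [Aa [Ba ->]]]]]].
  have [g sg] := Fsheet _ FA; have [g' sg'] := Gsheet _ GB.
  have oS : open (S a A B) by apply: open_box => //; [case: sg|case: sg'].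
  split=> //; apply: (@open_injective_restricts_to_homeo _ _ _ _ _ (cls ca)) => //.
  + by apply/free_homotopic_repr; exact: free_homotopic_refl.
  + exact: Pi_map_continuous.
  + exact: Pi_map_open.
  (* Equal images force equal starting points, both lying in the single sheet [A]; then the homotopy
     lifts. *)
  + elim/Pi_ind => f1 cf1; elim/Pi_ind => f2 cf2; rewrite !inE.
    move=> /free_homotopic_repr af1 /free_homotopic_repr af2.
    rewrite !Pi_map_cls => /cls_eq pf12; apply/cls_eq.
    apply: (homotopic_lift cp) => //.
    have [/= Af1 _] := free_homotopic_endsr af1.
    have [/= Af2 _] := free_homotopic_endsr af2.
    have [_ _ gA _] := sg.
    rewrite -(gA _ Af1).2 -(gA _ Af2).2; congr g.
    exact: (homotopic_ends pf12).1.
  + apply/seteqP; split=> [_ [c Sc <-]|]; first exact: W_lift Sc.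
    elim/Pi_ind => f cf /free_homotopic_repr hf.
    have hE : h = p \o a by apply/funext => t; rewrite -pa.
    rewrite hE in hf.
    have [b [cb pb ab]] := free_homotopic_lift cp sg sg' ca Aa Ba hf.
    exists (cls cb); first exact/free_homotopic_repr.
    exact: Pi_map_cls_eq.
Qed.

Lemma Pi_map_covering : covering_map (Pi_map R p).
Proof.
split; [exact: Pi_map_continuous|exact: Pi_map_surj|].
by elim/Pi_ind => h ch; exact: Pi_map_evenly_covered.
Qed.

End Pi_covering.

Lemma Pi_map_comp (R : realType) (X Y Z : topologicalType)
    (q : continuousType Y Z) (p : continuousType X Y) (r : continuousType X Z) :
  (forall x, r x = q (p x)) -> forall c, Pi_map R r c = Pi_map R q (Pi_map R p c).
Proof.
by move=> rE; elim/Pi_ind => f cf; rewrite (Pi_map_cls p) (Pi_map_cls q);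
  exact: Pi_map_cls_eq.
Qed.

Lemma Pi_map_id (R : realType) (X : topologicalType) (p : continuousType X X) :
  (forall x, p x = x) -> forall c, Pi_map R p c = c.
Proof.
by move=> pE; elim/Pi_ind => f cf; exact: Pi_map_cls_eq.
Qed.

(** * Deck transformations *)

Section Pi_deck.
Context (R : realType) (X Y : topologicalType) (p : continuousType Y X).
Local Notation I := (unit_interval R).
Context (gX : good_space R X) (gY : good_space R Y) (cp : covering_map p).

Definition deck_Pi_fun (f : deck p) : Pi R Y -> Pi R Y :=
  Pi_map R (mk_continuous (deck_homeo f).1).

Lemma deck_Pi_homeo f : homeomorphism (deck_Pi_fun f).
Proof.
split; first exact: Pi_map_continuous.
exists (deck_Pi_fun (deck_inv f)); have [_ fK Kf] := deck_inv_funP f.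
split=> [|c|c]; first exact: Pi_map_continuous.
- pose i := mk_continuous (fun y : Y => @cvg_id _ (nbhs y)).
  rewrite /deck_Pi_fun -(@Pi_map_comp _ _ _ _ _ _ i) ?Pi_map_id// => y.
  by rewrite /= fK.
- pose i := mk_continuous (fun y : Y => @cvg_id _ (nbhs y)).
  rewrite /deck_Pi_fun -(@Pi_map_comp _ _ _ _ _ _ i) ?Pi_map_id// => y.
  by rewrite /= Kf.
Qed.

Lemma deck_Pi_over f : Pi_map R p \o deck_Pi_fun f = Pi_map R p.
Proof.
apply/funext => c /=; rewrite /deck_Pi_fun -(@Pi_map_comp _ _ _ _ _ _ p)// => y.
by rewrite -[in LHS](deck_over f).
Qed.

Definition deck_Pi f : deck (Pi_map R p) := Deck (deck_Pi_homeo f) (deck_Pi_over f).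

Lemma deck_PiM : {morph deck_Pi : f g / deck_comp f g >-> deck_comp f g}.
Proof. by move=> f g; apply: deck_eqP => c; exact: Pi_map_comp. Qed.

Definition cst_cls (y : Y) : Pi R Y := cls (@cst_continuous I Y y).

Lemma src_cst_cls y : src (cst_cls y) = y.
Proof. by rewrite src_cls. Qed.

Lemma deck_Pi_cst f y : deck_Pi f (cst_cls y) = cst_cls (f y).
Proof.
exact: Pi_map_cls_eq.
Qed.

Lemma deck_Pi_inj : injective deck_Pi.
Proof.
move=> f g fg; apply: deck_eqP => y.
by rewrite -[LHS]src_cst_cls -[RHS]src_cst_cls -!deck_Pi_cst fg.
Qed.

(* A deck transformation upstairs permutes the lifts of constant paths, which
   are again constant. *)
Lemma deck_of_Pi_cst (F : deck (Pi_map R p)) y :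
  F (cst_cls y) = cst_cls (src (F (cst_cls y))).
Proof.
have pF : Pi_map R p (F (cst_cls y)) = Pi_map R p (cst_cls y).
  exact: (congr1 (fun h => h (cst_cls y)) (deck_over F)).
have psrc : p (src (F (cst_cls y))) = p y.
  by rewrite -src_Pi_map pF src_Pi_map src_cst_cls.
move: (F (cst_cls y)) psrc pF; elim/Pi_ind => f cf.
rewrite !src_cls !Pi_map_cls => pf /cls_eq pfy; apply/cls_eq.
apply: (homotopic_lift cp) => //; first exact: cst_continuous.
by rewrite [_ \o cst _](_ : _ = p \o cst y)//; apply/funext => t /=.
Qed.

Lemma initial_segment_continuous (f : I -> Y) (cf : continuous f) (t : I) :
  continuous (fun s : I => f (lerp s zero t)).
Proof.
apply: (comp_continuous _ cf); apply: lerp_continuous; last 2 first.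
- exact: cst_continuous.
- exact: cst_continuous.
- by move=> ?; exact: cvg_id.
Qed.

Lemma initial_segments_continuous (f : I -> Y) (cf : continuous f) :
  continuous (fun t => cls (@initial_segment_continuous f cf t)).
Proof.
move=> t0 N /(nbhs_cls gY)[U [V [oU oV]]]; rewrite lerp0 lerp1 => Uf Vf UVN.
have [e e0 eV] := nbhs_ivalP (cf t0 _ (open_nbhs_nbhs (conj oV Vf))).
apply: filterS (nbhs_ival t0 e0) => t /= te; apply: UVN.
(* Only the final time moves, between [t0] and [t]; the start stays fixed. *)
exists (fun wt => f (lerp wt.2 zero (lerp wt.1 t0 t))).
split=> [|s|s|w] /=; rewrite ?lerp0 ?lerp1//.
- apply: (comp_continuous _ cf); apply: lerp_continuous; first exact: snd_continuous.
    exact: cst_continuous.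
  by apply: lerp_continuous; [exact: fst_continuous|exact: cst_continuous..].
- by split=> //=; apply/eV/lerp_ball => //; rewrite subrr normr0.
Qed.

(* Two deck transformations upstairs agreeing on the constant paths agree on
   every class, because a path is joined to a constant one by its initial
   segments. *)
Lemma deck_Pi_ext (F G : deck (Pi_map R p)) :
  (forall y, F (cst_cls y) = G (cst_cls y)) -> F = G.
Proof.
move=> FG; apply: deck_eqP; elim/Pi_ind => f cf.
pose D t := cls (@initial_segment_continuous f cf t).
have D1 : D one = cls cf.
  apply/cls_eq; rewrite (_ : (fun s => _) = f); first exact: homotopic_refl.
  apply/funext => s; congr f; apply: ival_inj.
  by rewrite ival_lerp ival_zero ival_one; lra.
have D0 : D zero = cst_cls (f zero).
  apply/cls_eq; rewrite (_ : (fun s => _) = cst (f zero)).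
    by apply: homotopic_refl; exact: cst_continuous.
  by apply/funext => s; rewrite lerpxx.
rewrite -D1; apply: (unique_lift (Pi_map_covering gX gY cp)
  (f := F \o D) (g := G \o D) (s0 := zero)).
- apply: comp_continuous; first exact: initial_segments_continuous.
  exact: (deck_homeo F).1.
- apply: comp_continuous; first exact: initial_segments_continuous.
  exact: (deck_homeo G).1.
- move=> t; rewrite -[LHS]/((Pi_map R p \o F) (D t)).
  by rewrite -[RHS]/((Pi_map R p \o G) (D t)) !deck_over.
- by rewrite /= D0.
Qed.

Lemma deck_Pi_surj F : exists f, deck_Pi f = F.
Proof.
pose d (H : deck (Pi_map R p)) y := src (H (cst_cls y)).
have dE (H : deck (Pi_map R p)) y : H (cst_cls y) = cst_cls (d H y).
  exact: deck_of_Pi_cst.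
have cd H : continuous (d H).
  apply: (comp_continuous _ (src_continuous gY)).
  apply: (comp_continuous _ (deck_homeo H).1).
  exact: cst_cls_continuous.
have [_ FK KF] := deck_inv_funP F.
(* Since [dE] says that [H] acts on constant classes through [d H], the inverse of [F] induces the
   inverse of [d F]. *)
have dh : homeomorphism (d F).
  split=> //; exists (d (deck_inv F)); split=> // y.
    by rewrite -[RHS]src_cst_cls /d -dE /= FK.
  by rewrite -[RHS]src_cst_cls /d -dE /= KF.
have dp : p \o d F = p.
  apply/funext => y /=; rewrite /d -src_Pi_map -[RHS]/(p y).
  rewrite -[Pi_map R p _]/((Pi_map R p \o F) _) deck_over.
  by rewrite src_Pi_map src_cst_cls.
exists (Deck dh dp); apply: deck_Pi_ext => y.
by rewrite deck_Pi_cst dE.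
Qed.

Lemma deck_Pi_iso :
  exists phi : {multiplicative deck p -> deck (Pi_map R p)}, bijective phi.
Proof.
pose phi : {multiplicative deck p -> deck (Pi_map R p)} :=
  HB.pack deck_Pi
    (isMultiplicative.Build (deck p) (deck (Pi_map R p)) deck_Pi deck_PiM).
exists phi; have /choice[psi psiK] := deck_Pi_surj.
by exists psi; [apply: (inj_can_sym psiK); exact: deck_Pi_inj|].
Qed.

End Pi_deck.

(** * Simply connected spaces *)

Section simply_connected.
Context (R : realType) (Z : topologicalType).
Local Notation I := (unit_interval R).
Context (scZ : simply_connected R Z) (lpcZ : locally_path_connected R Z).

Lemma simply_connected_good : good_space R Z.
Proof.
split=> //; first by case: scZ.
by move=> z; exists setT; split=> //; [exact: openT|exact: scZ.2].
Qed.

Let gZ := simply_connected_good.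

Lemma Pi_eq (c c' : Pi R Z) : src c = src c' -> tgt c = tgt c' -> c = c'.
Proof.
elim/Pi_ind: c => f cf; elim/Pi_ind: c' => g cg; rewrite !src_cls !tgt_cls.
by move=> fg0 fg1; apply/cls_eq/simply_connected_homotopic.
Qed.

(** Collars inside [U] and [V] extend [f] to a path with the ends of [g], which simple connectedness
    identifies with [g]. *)
Lemma simply_connected_free_homotopic (U V : set Z) (f g : I -> Z) :
  path_connected R U -> path_connected R V -> continuous f -> continuous g ->
  U (f zero) -> U (g zero) -> V (f one) -> V (g one) ->
  free_homotopic (U `*` V) f g.
Proof.
move=> [_ pcU] [_ pcV] cf cg Uf Ug Vf Vg.
have [a aU] := pcU _ _ Ug Uf; have [b bV] := pcV _ _ Vf Vg.
have ca : continuous a by exact: cts_fun.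
have cb : continuous b by exact: cts_fun.
pose h := concat_fun (concat_fun a f) b.
have afb : free_homotopic (U `*` V) f h.
  apply: free_homotopic_concat; rewrite ?path_zero ?path_one//.
  by move=> s; split=> /=; [apply: aU; eexists|apply: bV; eexists].
apply: (free_homotopic_trans afb); apply: homotopic_free.
  exact: free_homotopic_endsr afb.
apply: simply_connected_homotopic => //; first exact: free_homotopic_continuousr afb.
- by rewrite /h !concat_fun0 path_zero.
- by rewrite /h concat_fun1 path_one.
Qed.

Lemma Pi_of_ends_exists (ab : Z * Z) :
  exists c : Pi R Z, src c = ab.1 /\ tgt c = ab.2.
Proof.
have [[_ pcZ] _] := scZ; have [f _] := pcZ ab.1 ab.2 Logic.I Logic.I.
have cf : continuous f by exact: cts_fun.
by exists (cls cf); rewrite src_cls tgt_cls path_zero path_one.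
Qed.

Definition Pi_of_ends ab : Pi R Z := projT1 (cid (Pi_of_ends_exists ab)).

Lemma src_of_ends ab : src (Pi_of_ends ab) = ab.1.
Proof. exact: (projT2 (cid (Pi_of_ends_exists ab))).1. Qed.

Lemma tgt_of_ends ab : tgt (Pi_of_ends ab) = ab.2.
Proof. exact: (projT2 (cid (Pi_of_ends_exists ab))).2. Qed.

Lemma Pi_of_endsK c : Pi_of_ends (src c, tgt c) = c.
Proof. by apply: Pi_eq; rewrite ?src_of_ends ?tgt_of_ends. Qed.

(* Since a class is determined by its endpoints, boxes form a basis. *)
Lemma nbhs_Pi_box (c : Pi R Z) (N : set (Pi R Z)) : nbhs c N ->
  exists U V, [/\ nice R U, nice R V, U (src c), V (tgt c) &
    forall c', U (src c') -> V (tgt c') -> N c'].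
Proof.
elim/Pi_ind: c => f cf /(nbhs_cls gZ)[U [V [oU oV Uf Vf UVN]]].
rewrite src_cls tgt_cls.
have [A [nA Af AU]] := nice_nbhs gZ (open_nbhs_nbhs (conj oU Uf)).
have [B [nB Bf BV]] := nice_nbhs gZ (open_nbhs_nbhs (conj oV Vf)).
exists A, B; split=> //; elim/Pi_ind => g cg; rewrite src_cls tgt_cls => Ag Bg.
apply: UVN; apply: (@free_homotopicS _ _ (A `*` B)).
  by move=> -[? ?] [? ?]; split; [exact: AU|exact: BV].
by apply: simply_connected_free_homotopic => //; [case: nA|case: nB].
Qed.

Lemma Pi_of_ends_continuous : continuous Pi_of_ends.
Proof.
move=> [a b] N /nbhs_Pi_box[U [V [[oU _ _] [oV _ _]]]].
rewrite src_of_ends tgt_of_ends => Ua Vb UVN.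
exists (U, V); first by split; exact: open_nbhs_nbhs.
by move=> [a' b'] [/= Ua' Vb']; apply: UVN; rewrite ?src_of_ends ?tgt_of_ends.
Qed.

Lemma path_connected_Pi_box (U V : set Z) :
  path_connected R U -> path_connected R V ->
  path_connected R [set c : Pi R Z | U (src c) /\ V (tgt c)].
Proof.
move=> [[u Uu] pcU] [[v Vv] pcV]; split.
  by exists (Pi_of_ends (u, v)); rewrite /= src_of_ends tgt_of_ends.
move=> c c' [Uc Vc] [Uc' Vc'].
have [a aU] := pcU _ _ Uc Uc'; have [b bV] := pcV _ _ Vc Vc'.
pose l t := Pi_of_ends (a t, b t).
have cl : continuous l.
  apply: (comp_continuous _ Pi_of_ends_continuous).
  by apply: continuous_pair; exact: cts_fun.
have l0 : l zero = c by rewrite /l !path_zero Pi_of_endsK.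
have l1 : l one = c' by rewrite /l !path_one Pi_of_endsK.
exists (mk_path cl l0 l1) => _ [t _ <-].
rewrite -[X in _ X]/(l t) /= /l src_of_ends tgt_of_ends.
by split=> /=; [apply: aU; eexists|apply: bV; eexists].
Qed.

(** The loops traced by the two endpoints are contracted separately in [Z], and [Pi_of_ends]
    recombines the contractions. *)
Lemma simply_connected_Pi : simply_connected R (Pi R Z).
Proof.
have [pcZ tZ] := scZ; split.
  rewrite (_ : setT = [set c : Pi R Z | setT (src c) /\ setT (tgt c)]).
    exact: path_connected_Pi_box.
  by apply/seteqP; split.
move=> c l _; have cl : continuous l by exact: cts_fun.
have ends_null (e : Pi R Z -> Z) : continuous e -> homotopic (e \o l) (cst (e c)).
  move=> ce; have cel := comp_continuous cl ce.
  have el0 : e (l zero) = e c by rewrite path_zero.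
  have el1 : e (l one) = e c by rewrite path_one.
  exact: (tZ _ (mk_path cel el0 el1)).
have [H [cH H0 H1 Hz Ho]] := ends_null _ (src_continuous gZ).
have [K [cK K0 K1 Kz Ko]] := ends_null _ (tgt_continuous gZ).
exists (fun st => Pi_of_ends (H st, K st)); split=> [|t|t|s|s].
- apply: (comp_continuous _ Pi_of_ends_continuous); exact: continuous_pair.
- by rewrite H0 K0 Pi_of_endsK.
- by rewrite H1 K1 Pi_of_endsK.
- by rewrite Hz Kz Pi_of_endsK.
- by rewrite Ho Ko Pi_of_endsK.
Qed.

Lemma locally_path_connected_Pi : locally_path_connected R (Pi R Z).
Proof.
move=> c W /nbhs_Pi_box[U [V [[oU pcU _] [oV pcV _] Uc Vc UVW]]].
exists [set c : Pi R Z | U (src c) /\ V (tgt c)]; split=> //.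
- rewrite -[X in open X]/((@src R Z) @^-1` U `&` (@tgt R Z) @^-1` V).
  apply: openI; apply: open_comp => // ? _; first exact: src_continuous.
  exact: tgt_continuous.
- exact: path_connected_Pi_box.
- by move=> c' [Uc' Vc']; exact: UVW.
Qed.

End simply_connected.

Theorem theorem3p2 (R : realType) (X : topologicalType) (gX : good_space R X) :
  (forall (Y : topologicalType) (p : continuousType Y X),
     good_space R Y -> covering_map p ->
     covering_map (Pi_map R p) /\
     exists phi : {multiplicative deck p -> deck (Pi_map R p)},
       bijective phi) /\
  (forall (Xt : topologicalType) (q : continuousType Xt X),
     universal_covering R q ->
     universal_covering R (Pi_map R q)).
Proof.
split=> [Y p gY cp|Xt q [cq scXt lpcXt]].
  by split; [exact: Pi_map_covering|exact: deck_Pi_iso].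
have gXt := simply_connected_good scXt lpcXt.
split; [exact: Pi_map_covering|exact: simply_connected_Pi|].
exact: locally_path_connected_Pi.
Qed.
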